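(* Let $T>0$ and integers $J\ge1$, $m\ge1$ be given. There exists a constant $C=C(J,T,m)>0$ such that the following holds. Run the EIM-POD-Greedy method with $m$ POD modes per iteration on a parametrized family $\mathcal{F}_T=\{a_\mu:\mu\in\mathcal{P}\}\subset V_T$, with slice set $\mathcal{F}\subset V$, interpolation operators $\Pi_n=\Pi_{n,m}$, and eigenvalues $\lambda_n^1\ge\cdots\ge\lambda_n^m$. Put $\Lambda_n:=\|\Pi_n\|$ and $\theta_n:=\lambda_n^m/\lambda_n^1$. Then for each $n\ge1$, $$\hat\sigma_n\le C(1+\Lambda_{n-1})\Big(\prod_{i=1}^n(1+\Lambda_{i-1})\sqrt{\theta_i}^{\,-1}\Big)^{\frac1n}n^{\frac12}\,\varepsilon_{mn}(\mathrm{co}(\mathcal{F})).$$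
   Context: Setting: $V$ is a real Hilbert space, with inner product $\langle\cdot,\cdot\rangle$ and norm $\|\cdot\|$, of real functions on a domain $\Omega$ (the functions involved can be evaluated at the points of the candidate set $\Sigma$). $\tau:=T/J$, $t_j:=j\tau$ for $0\le j\le J$, $\mathbb{I}:=\{t_j\}_{j=0}^J$. For a subspace $W\subset V$, $L^2(\mathbb{I};W)$ denotes $W^{J+1}$ with inner product $\langle u,v\rangle_{V_T}:=\sum_{j=0}^J\tau\langle u^j,v^j\rangle$; $V_T:=L^2(\mathbb{I};V)$, with norm $\|\cdot\|_{V_T}$. $\mathcal{P}\subset\mathbb{R}^d$ is a parameter set and $\mathcal{F}_T=\{a_\mu:\mu\in\mathcal{P}\}$ is a family of functions on $\mathbb{I}\times\Omega$, regarded as elements $a_\mu=(a_\mu(t_0),\dots,a_\mu(t_J))\in V_T$. $\mathcal{F}:=\{a_\mu(t_j)\in V:\mu\in\mathcal{P},\ 0\le j\le J\}$. For $v=(v^0,\dots,v^J)\in V_T$, the correlation operator is $C_v:V\to V$, $C_v(w):=\sum_{j=0}^J\tau\langle v^j,w\rangle v^j$. EIM-POD-Greedy method. Input: $\mathcal{F}_T$, a set $\Sigma\subset\Omega$ of candidate interpolation points, and $m$. Initialize $V_0=\{0\}$, $V_{T,0}=L^2(\mathbb{I};V_0)$, $\Pi_{T,0}=0$, $\Pi_{0,m}=0$. For $n=1,2,\dots$: (1) select $a_{\mu_n}\in\mathcal{F}_T$ with $\|a_{\mu_n}-\Pi_{T,n-1}a_{\mu_n}\|_{V_T}=\sup_{a_\mu\in\mathcal{F}_T}\|a_\mu-\Pi_{T,n-1}a_\mu\|_{V_T}$;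 (2) set $r_n:=a_{\mu_n}-\Pi_{T,n-1}a_{\mu_n}$ and compute the first $m$ eigenpairs $(\lambda_n^1,f_n^1),\dots,(\lambda_n^m,f_n^m)$ of $C_{r_n}$, where $\lambda_n^1\ge\cdots\ge\lambda_n^m$ are its $m$ largest eigenvalues counted with multiplicity and $C_{r_n}(f_n^k)=\lambda_n^kf_n^k$ with $f_n^1,\dots,f_n^m$ orthonormal; set $\Pi_{n,0}:=\Pi_{n-1,m}$; (3) for $k=1,\dots,m$: let $r_n^k:=f_n^k-\Pi_{n,k-1}f_n^k$; select $x_{(n-1)m+k}\in\Sigma$ with $|r_n^k(x_{(n-1)m+k})|=\sup_{x\in\Sigma}|r_n^k(x)|$ (assumed nonzero, so that the next step makes sense); set $q_{(n-1)m+k}:=r_n^k/r_n^k(x_{(n-1)m+k})$, $B_{n,k}:=(q_j(x_i))_{1\le i,j\le(n-1)m+k}$, and define the interpolation operator $\Pi_{n,k}g:=(q_1,\dots,q_{(n-1)m+k})\,B_{n,k}^{-1}\,(g(x_1),\dots,g(x_{(n-1)m+k}))^\top$; (4) set $V_n:=\mathrm{span}\{q_1,\dots,q_{mn}\}$, $V_{T,n}:=L^2(\mathbb{I};V_n)$, and define $\Pi_{T,n}:\mathcal{F}_T\to V_{T,n}$ by $(\Pi_{T,n}a_\mu)^j:=\Pi_{n,m}(a_\mu(t_j))$, $0\le j\le J$. Write $\Pi_n:=\Pi_{n,m}$ (so $\Pi_0=0$). Its norm is $\|\Pi_n\|:=\sup_{0\ne v\in\mathrm{span}\{\mathcal{F}\}}\|\Pi_nv\|/\|v\|$.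 The error is $\hat\sigma_n:=\sup_{\mu\in\mathcal{P}}\|a_\mu-\Pi_{T,n-1}a_\mu\|_{V_T}$. Symmetric convex hull: for $K\subset V$, $\mathrm{co}(K)$ is the closure of $\{\sum_i c_ig_i:c_i\in\mathbb{R},\ \sum_i|c_i|\le1,\ g_i\in K\}$. Entropy numbers: $\varepsilon_n(\mathrm{co}(K)):=\inf\{\varepsilon>0:\mathrm{co}(K)\text{ is covered by }2^n\text{ balls of }V\text{ of radius }\varepsilon\}$. Convention: the quotients $\theta_i$ are assumed to be defined ($\lambda_i^1>0$), and the right-hand side is understood as $+\infty$ if some $\theta_i=0$. *)

(* Defs.v *)
From HB Require Import structures.
From mathcomp Require Import all_boot all_order all_algebra.
From mathcomp Require Import all_classical all_reals all_analysis.
Import Order.TTheory GRing.Theory Num.Theory.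
Import numFieldNormedType.Exports.

Set Implicit Arguments.
Unset Strict Implicit.
Unset Printing Implicit Defensive.

Local Open Scope classical_set_scope.
Local Open Scope ring_scope.

Section LinearAlgebra.
Context {R : realType} {V : lmodType R}.

Definition lin_span (A : set V) : set V :=
  [set v | exists (p : nat) (c : 'I_p -> R) (g : 'I_p -> V),
    (forall i, A (g i)) /\ v = \sum_i c i *: g i].

Definition lin_indep (p : nat) (g : 'I_p -> V) : Prop :=
  forall c : 'I_p -> R, \sum_i c i *: g i = 0 -> forall i, c i = 0.

Definition has_dim (W : set V) (p : nat) : Prop :=
  exists g : 'I_p -> V, lin_indep g /\ W = lin_span (range g).

(* {0} if mu is not an eigenvalue *)
Definition eigenspace_of (A : V -> V) (mu : R) : set V :=
  [set w | A w = mu *: w].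

End LinearAlgebra.

(* Point evaluation at the points of Sigma.  It is only required on a linear
   subspace of V, so that V may be a space such as L^2, some elements of which
   have no point values; no continuity is assumed. *)
Record evaluation (R : realType) (V : lmodType R) (Omega : Type)
    (Sigma : set Omega) := Evaluation {
  evaluable : set V ;
  eval :> V -> Omega -> R ;
  evaluable0 : evaluable 0 ;
  evaluableP : forall (c : R) (u v : V),
    evaluable u -> evaluable v -> evaluable (c *: u + v) ;
  evalP : forall (c : R) (u v : V) (y : Omega),
    evaluable u -> evaluable v -> Sigma y ->
    eval (c *: u + v) y = c * eval u y + eval v y }.

Section Entropy.
Context {R : realType} {V : normedModType R}.

Definition sym_convex_hull (K : set V) : set V :=
  closure [set v | exists (p : nat) (c : 'I_p -> R) (g : 'I_p -> V),
    [/\ forall i, K (g i), \sum_i `|c i| <= 1 & v = \sum_i c i *: g i]].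

(* +oo when the set of admissible radii is empty *)
Definition entropy_number (n : nat) (K : set V) : \bar R :=
  ereal_inf [set e%:E | e in [set e : R | 0 < e /\
    exists c : 'I_(2 ^ n) -> V, K `<=` \bigcup_i ball (c i) e]].

End Entropy.

Section TimeSlices.
Context {R : realType} {V : lmodType R}.
Variables (dot : {dot V for (@idfun R)}) (T : R) (J : nat).

Definition tau : R := T / J%:R.

(* v : 'I_J.+1 -> V is an element of V_T, v j being its value at t_j = j tau *)
Definition dotT (u v : 'I_J.+1 -> V) : R :=
  \sum_(j < J.+1) tau * dot (u j) (v j).

Definition normT (v : 'I_J.+1 -> V) : R := Num.sqrt (dotT v v).

Definition correlation (v : 'I_J.+1 -> V) (w : V) : V :=
  \sum_(j < J.+1) (tau * dot (v j) w) *: v j.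

End TimeSlices.

Section LeadingEigenpairs.
Context {R : realType} {V : lmodType R}.
Variable dot : {dot V for (@idfun R)}.

(* lam 1, ..., lam m are the m largest eigenvalues of A, counted with
   multiplicity, with orthonormal eigenvectors f 1, ..., f m: every eigenvalue
   above lam m is listed as many times as the dimension of its eigenspace. *)
Definition leading_eigenpairs (A : V -> V) (m : nat)
    (lam : nat -> R) (f : nat -> V) : Prop :=
  [/\ forall k, (1 <= k <= m)%N -> A (f k) = lam k *: f k,
      forall k l, (1 <= k <= m)%N -> (1 <= l <= m)%N ->
        dot (f k) (f l) = (k == l)%:R,
      forall k l, (1 <= k)%N -> (k <= l)%N -> (l <= m)%N -> lam l <= lam k
    & forall mu, lam m < mu ->
        has_dim (eigenspace_of A mu)
          (count (fun k => lam k == mu) (iota 1 m))].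

End LeadingEigenpairs.

(* Output of the algorithm.  All indices start at 1, so the values at 0 are
   irrelevant; points and basis functions are numbered by (n - 1) m + k. *)
Record eim_data (R : realType) (V : Type) (Omega : Type) (d : nat) := EimData {
  sel : nat -> 'rV[R]_d ;
  eigval : nat -> nat -> R ;
  eigvec : nat -> nat -> V ;
  pt : nat -> Omega ;
  bas : nat -> V }.

Section EimPodGreedy.
Context {R : realType} {V : completeNormedModType R} {Omega : Type} {d : nat}.
Variables (dot : {dot V for (@idfun R)}) (T : R) (J m : nat).
Context {Sigma : set Omega}.
Variables (ev : evaluation V Sigma).
Variables (P : set 'rV[R]_d) (a : 'rV[R]_d -> 'I_J.+1 -> V).
Variable D : eim_data R V Omega d.

Definition slices : set V :=
  [set v | exists2 mu, P mu & exists j : 'I_J.+1, v = a mu j].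

Definition interp_mx (p : nat) : 'M[R]_p :=
  \matrix_(i < p, j < p) ev (bas D j.+1) (pt D i.+1).

(* Interpolation with the first p points and basis functions.  Pi_{n,k} is
   [interp ((n - 1) m + k)], which builds in Pi_{n,0} = Pi_{n-1,m}; and
   [interp 0] is 0. *)
Definition interp (p : nat) (g : V) : V :=
  \sum_(j < p)
    (invmx (interp_mx p) *m (\col_(i < p) ev g (pt D i.+1))) j 0
      *: bas D j.+1.

Definition Pi (n : nat) : V -> V := interp (n * m).

Definition PiT (n : nat) (v : 'I_J.+1 -> V) : 'I_J.+1 -> V :=
  fun j => Pi n (v j).

Definition residualT (n : nat) (mu : 'rV[R]_d) : 'I_J.+1 -> V :=
  fun j => a mu j - PiT n.-1 (a mu) j.

Definition sigma_hat (n : nat) : \bar R :=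
  ereal_sup [set (normT dot T (residualT n mu))%:E | mu in P].

Definition residual (n k : nat) : V :=
  eigvec D n k - interp (n.-1 * m + k.-1) (eigvec D n k).

Definition interp_step (n k : nat) : Prop :=
  let i := (n.-1 * m + k)%N in let r := residual n k in
  [/\ evaluable ev (eigvec D n k),
      Sigma (pt D i),
      (`|ev r (pt D i)|)%:E = ereal_sup [set (`|ev r y|)%:E | y in Sigma],
      ev r (pt D i) != 0
    & bas D i = (ev r (pt D i))^-1 *: r].

Definition greedy_step (n : nat) : Prop :=
  [/\ P (sel D n),
      (normT dot T (residualT n (sel D n)))%:E = sigma_hat n,
      leading_eigenpairs dot (correlation dot T (residualT n (sel D n))) m
        (eigval D n) (eigvec D n)
    & forall k, (1 <= k <= m)%N -> interp_step n k].

(* D records N iterations of the EIM-POD-Greedy method. *)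
Definition eim_pod_greedy (N : nat) : Prop :=
  (forall mu j, P mu -> evaluable ev (a mu j)) /\
  (forall n, (1 <= n <= N)%N -> greedy_step n).

(* Lambda_n, possibly +oo *)
Definition Lambda (n : nat) : \bar R :=
  ereal_sup [set (`|Pi n v| / `|v|)%:E |
    v in [set v | lin_span slices v /\ v != 0]].

Definition theta (n : nat) : R := eigval D n m / eigval D n 1%N.

End EimPodGreedy.

(* Main.v *)
Require Import Defs.
From HB Require Import structures.
From mathcomp Require Import all_boot all_order all_algebra.
From mathcomp Require Import all_classical all_reals all_analysis.
From mathcomp Require Import ring lra complex.
Import Order.TTheory GRing.Theory Num.Theory.
Import numFieldNormedType.Exports.

Local Open Scope classical_set_scope.
Local Open Scope ring_scope.

(** Volumes. Suppose that vectors [h_0, ..., h_{p-1}] of a Hilbert space are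
    such that every [h_t] has distance at least [delta_t] from the span of its
    predecessors, and that every combination of the [h_t] with coefficients of
    absolute sum at most 1 lies in a set covered by [2 ^ p] balls of radius
    [e]. A comparison of volumes bounds the product of the [delta_t] by [(C e
    sqrt p) ^ p], since the cross-polytope spanned by the [h_t] has volume [2
    ^ p / p!] times that product or more, and a ball of radius [e] has volume
    at most [(C e / sqrt p) ^ p]. In [prod_dist_le_cover] both volumes are
    replaced by numbers of points of a fine lattice: [M ^ p] lattice points
    lie in the hull, and the number of those in one ball is bounded by a sum
    over the lattice of the products of the weights [expR (- |u|)], where [u]
    runs over the scaled coordinates in a Gram-Schmidt basis. The change of
    coordinates is triangular, so the sum is at most a product of
    one-dimensional ones ([sum_prod_triangular]), each of them a sum of two
    geometric series ([expR_sum_lattice]).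

    The vectors. Let [r_j] be the slices of the greedy residual of iteration
    [b + 1], and [f] one of its eigenvectors, with eigenvalue [lam]. The
    eigenvalue equation [lam f = sum_j tau <r_j, f> r_j] has coefficients of
    absolute sum at most [c0 sqrt lam], where [c0] depends on [T] and [J]
    only. Replacing each [r_j] by the slice from which it comes, and dividing
    by [c0 sqrt lam], gives a vector of the symmetric convex hull of the
    slices that equals [(sqrt lam / c0) f] up to an element of [V_b]
    ([pod_vec], [pod_vec_decomp]). The interpolation operator [Pi_b] vanishes
    on the residual, hence on [f], is the identity on [V_b], and has norm
    [Lambda_b] on the span of the slices; so [f], even when combined with the
    earlier eigenvectors of the same iteration, has distance at least [1 / (1
    + Lambda_b)] from [V_b] ([dist_flag_ge]). With [p = m n] this bounds the
    geometric mean over [b] of [sqrt lam^m_b / (1 + Lambda_b)] by a multiple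
    of [sqrt n] times the entropy number ([eigval_volume_le]).

    The errors. Since the largest eigenvalue of the correlation operator is at
    least its trace divided by [J + 1] ([dotT_le_eigval1]), the error of
    iteration [b + 1] is at most a constant times [sqrt lam^1_b = sqrt lam^m_b
    / sqrt theta_b]. The error of the last iteration is at most [1 +
    Lambda_{n-1}] times that of any earlier one ([residual_norm_le]), because
    the spaces [V_b] increase. The claim follows on taking [n]-th roots
    ([sigma_bound]). When some [Lambda] is infinite or some [theta] vanishes,
    the right-hand side is infinite, as the entropy number is positive
    ([entropy_number_gt0]). *)

(** * Lattice sums *)

(** The point is uniformity in the shift [s]: the terms on either side of the
    sign change form a geometric series of ratio [expR (- d)], so the sum is at
    most [2 / (1 - expR (- d))]. *)
Lemma expR_sum_lattice (R : realType) (d s : R) (M : nat) : 0 < d -> d <= 1 ->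
  \sum_(k < M) expR (- `|d * k%:R + s|) <= 2 * expR 1 / d.
Proof.
move=> d0 d1; pose q := expR (- d).
(* [B s / (1 - q)] is the sum of the series over all [k >= 0] when [s >= 0];
   for [s < 0] the constant 2 makes
   [(1 - q) expR (- |s|) + B (s + d) <= B s], the induction step, hold. *)
pose B (s : R) := if 0 <= s then expR (- s) else 2 - q * expR s.
have q0 : 0 < q by exact: expR_gt0.
have q1 : q < 1 by rewrite /q -expR0 ltr_expR oppr_lt0.
have main : (1 - q) * \sum_(k < M) expR (- `|d * k%:R + s|) <= B s.
  elim: M s => [|M IH] s.
    rewrite big_ord0 mulr0 /B; case: ifPn => [_|]; first exact: expR_ge0.
    rewrite -ltNge => s0.
    have e1 : expR s <= 1 by rewrite -expR0 ler_expR ltW.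
    have e0 := expR_ge0 s.
    have : q * expR s <= 1 by nra.
    lra.
  rewrite big_ord_recl mulr0 add0r.
  under eq_bigr => k _.
    have -> : d * (lift ord0 k)%:R + s = d * k%:R + (s + d).
      rewrite lift0 -natr1; ring.
    over.
  have := IH (s + d).
  set S := \sum_(k < M) _ => hS.
  rewrite mulrDr; apply: le_trans (lerD (lexx _) hS) _.
  rewrite /B; have [s0|s0] := leP 0 s.
    have -> : 0 <= s + d by lra.
    rewrite ger0_norm // opprD expRD -/q; lra.
  rewrite ltr0_norm // opprK.
  have e1 : expR s <= 1 by rewrite -expR0 ler_expR ltW.
  case: ifPn => [sd|_].
    have e2 : expR (- (s + d)) <= 1 by rewrite -expR0 ler_expR oppr_le0.
    lra.
  have -> : q * expR (s + d) = expR s.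
    by rewrite /q -expRD; congr expR; ring.
  lra.
have B2 : B s <= 2.
  rewrite /B; case: ifPn => s0.
    have : expR (- s) <= 1 by rewrite -expR0 ler_expR oppr_le0.
    lra.
  have := mulr_ge0 (ltW q0) (expR_ge0 s); lra.
have qd : d <= expR 1 * (1 - q).
  have h1 := expR_ge1Dx d.
  have h2 : expR d * q = 1 by rewrite /q -expRD subrr expR0.
  have h3 : expR d <= expR 1 by rewrite ler_expR.
  have : (expR 1 - expR d) * (1 - q) >= 0 by apply: mulr_ge0; lra.
  nra.
rewrite ler_pdivlMr // mulrC.
set S := \sum_(k < M) _ in main *.
have S0 : 0 <= S by apply: sumr_ge0 => k _; exact: expR_ge0.
apply: le_trans (ler_wpM2r S0 qd) _.
rewrite -mulrA mulrC ler_wpM2r ?expR_ge0 //; exact: le_trans main B2.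
Qed.

Lemma sum_ffun_recl (R : realType) (p M : nat) (F : 'I_M -> {ffun 'I_p -> 'I_M} -> R) :
  \sum_(k : {ffun 'I_p.+1 -> 'I_M}) F (k ord0) [ffun i => k (lift ord0 i)]
  = \sum_(k : {ffun 'I_p -> 'I_M}) \sum_(i < M) F i k.
Proof.
rewrite pair_bigA /=.
pose h (z : {ffun 'I_p -> 'I_M} * 'I_M) : {ffun 'I_p.+1 -> 'I_M} :=
  [ffun i => if unlift ord0 i is Some j then z.1 j else z.2].
pose g (k : {ffun 'I_p.+1 -> 'I_M}) : {ffun 'I_p -> 'I_M} * 'I_M :=
  ([ffun i => k (lift ord0 i)], k ord0).
have hg : cancel h g.
  move=> [z y]; congr pair.
    by apply/ffunP => i; rewrite !ffunE liftK.
  by rewrite ffunE unlift_none.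
have gh : cancel g h.
  move=> k; apply/ffunP => i; rewrite ffunE.
  by case: unliftP => [j|] ->; rewrite ?ffunE.
rewrite (reindex h); last by exists g => ? _; rewrite ?hg ?gh.
apply: eq_bigr => [[z y] _] /=.
have e := hg (z, y); rewrite /g in e.
by case: e => -> ->.
Qed.

(** As [A] is upper triangular, the first coordinate of [k] occurs in the first
    factor alone; it can be summed first, with the other coordinates acting as
    a shift, which the bound [B 0] tolerates. *)
Lemma sum_prod_triangular (R : realType) (p M : nat) (phi : R -> R)
    (A : nat -> nat -> R) (s B : nat -> R) :
  (forall x, 0 <= phi x) ->
  (forall t x, (t < p)%N -> \sum_(k < M) phi (A t t * k%:R + x) <= B t) ->
  (forall t l, (l < t)%N -> (t < p)%N -> A t l = 0) ->
  \sum_(k : {ffun 'I_p -> 'I_M})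
     \prod_(t < p) phi (\sum_(l < p) A t l * (k l)%:R + s t)
  <= \prod_(t < p) B t.
Proof.
move=> phi0; elim: p A s B => [|p IH] A s B hB hA.
  rewrite big_ord0 (eq_bigr (fun=> 1)); last by move=> k _; rewrite big_ord0.
  by rewrite sumr_const card_ffun !card_ord expn0.
pose F (i : 'I_M) (k : {ffun 'I_p -> 'I_M}) :=
  phi (A 0 0 * i%:R + (\sum_(l < p) A 0 l.+1 * (k l)%:R + s 0)) *
  \prod_(t < p) phi (\sum_(l < p) A t.+1 l.+1 * (k l)%:R + s t.+1).
rewrite (eq_bigr (fun k : {ffun 'I_p.+1 -> 'I_M} =>
    F (k ord0) [ffun i => k (lift ord0 i)])); last first.
  move=> k _; rewrite big_ord_recl /F; congr (phi _ * _).
    rewrite big_ord_recl addrA; congr (_ + _ + _).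
    by apply: eq_bigr => l _; rewrite ffunE.
  apply: eq_bigr => t _; rewrite big_ord_recl lift0 (hA t.+1 0%N) ?ltnS // mul0r add0r.
  by congr (phi (_ + _)); apply: eq_bigr => l _; rewrite ffunE.
rewrite sum_ffun_recl big_ord_recl.
have B0 : 0 <= B 0%N.
  by apply: le_trans (hB 0%N 0 _) => //; apply: sumr_ge0.
apply: (@le_trans _ _ (\sum_(k : {ffun 'I_p -> 'I_M}) B 0%N *
   \prod_(t < p) phi (\sum_(l < p) A t.+1 l.+1 * (k l)%:R + s t.+1))).
  apply: ler_sum => k _; rewrite /F -mulr_suml.
  apply: ler_wpM2r; first by apply: prodr_ge0.
  exact: hB.
rewrite -mulr_sumr; apply: ler_wpM2l => //.
apply: (IH (fun t l => A t.+1 l.+1) (fun t => s t.+1) (fun t => B t.+1)).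
  by move=> t x tp; exact: hB.
by move=> t l lt tp; exact: hA.
Qed.

(** * Orthonormal systems *)

Section DotProduct.
Context {R : realType} {V : lmodType R} (dot : {dot V for (@idfun R)}).

Lemma dotC (u v : V) : dot u v = dot v u.
Proof. by rewrite hermC expr0 mul1r. Qed.

Lemma dotZr (c : R) (u v : V) : dot u (c *: v) = c * dot u v.
Proof. by rewrite dotC linearZl_LR dotC. Qed.

Lemma dotZl (c : R) (u v : V) : dot (c *: u) v = c * dot u v.
Proof. by rewrite linearZl_LR. Qed.

End DotProduct.

Section InnerProduct.
Context {R : realType} {V : normedModType R} (dot : {dot V for (@idfun R)}).
Hypothesis dot_norm : forall v : V, dot v v = `|v| ^+ 2.

Lemma bessel (p : nat) (e : nat -> V) (z : V) :
  (forall i j, (i < p)%N -> (j < p)%N -> dot (e i) (e j) = (i == j)%:R) ->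
  \sum_(t < p) (dot (e t) z) ^+ 2 <= `|z| ^+ 2.
Proof.
move=> eon.
pose y := \sum_(t < p) dot (e t) z *: e t.
have zy : dot z y = \sum_(t < p) (dot (e t) z) ^+ 2.
  rewrite /y linear_sumr; apply: eq_bigr => t _ /=.
  by rewrite dotZr dotC expr2.
have yy : dot y y = \sum_(t < p) (dot (e t) z) ^+ 2.
  rewrite {1}/y linear_sumlz; apply: eq_bigr => t _ /=.
  rewrite dotZl expr2 /y linear_sumr; congr (_ * _).
  rewrite (bigD1 t) //= big1 ?addr0 => [|i it].
    by rewrite dotZr eon // eqxx mulr1.
  by rewrite dotZr eon // eq_sym (negbTE (it : (i != t :> nat))) mulr0.
have : 0 <= dot (z - y) (z - y) by rewrite dot_norm sqr_ge0.
rewrite linearBl !linearBr -dot_norm /= (dotC dot y z) zy yy; lra.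
Qed.

(** Gram-Schmidt orthogonalisation.  The inner product of [e i] with [h i] is
    the distance from [h i] to the span of its predecessors, which is where the
    lower bound [delta i] comes from. *)
Lemma gram_schmidt (p : nat) (h : nat -> V) (delta : nat -> R) :
  (forall t, (t < p)%N -> 0 < delta t) ->
  (forall t (c : nat -> R), (t < p)%N ->
     delta t <= `|h t - \sum_(l < t) c l *: h l|) ->
  exists e : nat -> V,
  [/\ forall i j, (i < p)%N -> (j < p)%N -> dot (e i) (e j) = (i == j)%:R,
      forall i l, (i < p)%N -> (l < i)%N -> dot (e i) (h l) = 0 &
      forall i, (i < p)%N -> delta i <= dot (e i) (h i)].
Proof.
move=> d0 hd.
(* The induction also carries that the [h l] and the [e i] span the same
   space, in both directions. *)
suff [e [e1 [e2 [e3 _]]]] : exists e : nat -> V,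
  (forall i j, (i < p)%N -> (j < p)%N -> dot (e i) (e j) = (i == j)%:R) /\
  (forall i l, (i < p)%N -> (l < i)%N -> dot (e i) (h l) = 0) /\
  (forall i, (i < p)%N -> delta i <= dot (e i) (h i)) /\
  (forall l, (l < p)%N -> h l = \sum_(i < p) dot (e i) (h l) *: e i) /\
  (forall i, (i < p)%N -> exists c : nat -> R, e i = \sum_(l < p) c l *: h l).
  by exists e.
elim: p d0 hd => [|p IH] d0 hd.
  by exists (fun=> 0).
have [||e [e1 [e2 [e3 [e4 e5]]]]] := IH.
- by move=> t tp; apply: d0; exact: ltnW.
- by move=> t c tp; apply: hd; exact: ltnW.
have /choice [c hc] : forall i, exists c : nat -> R, (i < p)%N ->
    e i = \sum_(l < p) c l *: h l.
  move=> i; have [ip|ip] := ltnP i p; last by exists (fun=> 0).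
  by have [c hc] := e5 i ip; exists c.
pose w := h p - \sum_(i < p) dot (e i) (h p) *: e i.
have wE : w = h p - \sum_(l < p) (\sum_(i < p) dot (e i) (h p) * c i l) *: h l.
  rewrite /w; congr (_ - _).
  under [RHS]eq_bigr do rewrite scaler_suml.
  rewrite exchange_big; apply: eq_bigr => i _ /=.
  rewrite {2}(hc i) // scaler_sumr.
  by apply: eq_bigr => l _; rewrite scalerA.
have wd : delta p <= `|w|.
  by rewrite wE; apply: (hd p (fun l => \sum_(i < p) dot (e i) (h p) * c i l)).
have w0 : 0 < `|w| by apply: lt_le_trans wd; exact: d0.
have nK (n := `|w|) : n^-1 * (n^-1 * n ^+ 2) = 1.
  by rewrite expr2 mulKf ?mulVf ?gt_eqF.
have nK2 (n := `|w|) : n^-1 * n ^+ 2 = n by rewrite expr2 mulKf ?gt_eqF.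
have we i : (i < p)%N -> dot w (e i) = 0.
  move=> ip; rewrite /w linearBl linear_sumlz /= (bigD1 (Ordinal ip)) //=.
  rewrite big1 => [|j ji].
    by rewrite addr0 dotZl e1 // eqxx mulr1 dotC subrr.
  by rewrite dotZl e1 // (negbTE (ji : (j != i :> nat))) mulr0.
have wh l : (l < p)%N -> dot w (h l) = 0.
  move=> lp; rewrite (e4 l lp) linear_sumr big1 // => i _ /=.
  by rewrite dotZr we // mulr0.
have whp : dot w (h p) = `|w| ^+ 2.
  have -> : h p = w + \sum_(i < p) dot (e i) (h p) *: e i by rewrite /w subrK.
  rewrite linearDr /= dot_norm linear_sumr big1 ?addr0 // => i _ /=.
  by rewrite dotZr we // mulr0.
exists (fun i => if i == p then `|w|^-1 *: w else e i).
have nep i : (i < p)%N -> (i == p) = false by move=> ip; rewrite ltn_eqF.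
split; [|split; [|split; [|split]]].
- move=> i j; rewrite 2!ltnS (leq_eqVlt i) (leq_eqVlt j) => /predU1P[->|ip] /predU1P[->|jp].
  + by rewrite !eqxx dotZl dotZr dot_norm nK.
  + by rewrite eqxx nep // dotZl we // mulr0 eq_sym nep.
  + by rewrite eqxx nep // dotZr dotC we // mulr0.
  + by rewrite !nep // e1.
- move=> i l; rewrite ltnS leq_eqVlt => /predU1P[->|ip] li.
    by rewrite eqxx dotZl wh // mulr0.
  by rewrite nep // e2.
- move=> i; rewrite ltnS leq_eqVlt => /predU1P[->|ip].
    rewrite eqxx dotZl whp.
    by rewrite nK2.
  by rewrite nep // e3.
- move=> l; rewrite ltnS leq_eqVlt => /predU1P[->|lp].
    rewrite big_ord_recr /= eqxx dotZl whp scalerA mulrC nK scale1r.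
    under eq_bigr => i _ do rewrite nep //.
    by rewrite addrC /w subrK.
  rewrite big_ord_recr /= eqxx dotZl wh // mulr0 scale0r addr0.
  under eq_bigr => i _ do rewrite nep //.
  exact: e4.
- move=> i; rewrite ltnS leq_eqVlt => /predU1P[->|ip].
    exists (fun l => if l == p then `|w|^-1 else
      - (`|w|^-1 * \sum_(i < p) dot (e i) (h p) * c i l)).
    rewrite eqxx big_ord_recr /= eqxx {2}wE scalerBr addrC; congr (_ + _).
    rewrite scaler_sumr -sumrN; apply: eq_bigr => l _.
    by rewrite nep // scaleNr scalerA.
  exists (fun l => if l == p then 0 else c i l).
  rewrite nep // big_ord_recr /= eqxx scale0r addr0 {1}hc //.
  by apply: eq_bigr => l _; rewrite nep.
Qed.

End InnerProduct.

(** * Volume comparison and entropy numbers *)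

Section Entropy.
Context {R : realType} {V : normedModType R} (dot : {dot V for (@idfun R)}).
Hypothesis dot_norm : forall v : V, dot v v = `|v| ^+ 2.

(** A volume comparison by counting.  The [M ^ p] combinations [y k] of the [h l]
    with coefficients [k l / (p M)] lie in [S], hence in the balls.  On a ball,
    the coordinates [u_t] of [y k - x b] along the Gram-Schmidt basis, scaled by
    [sqrt p / r], have squares summing to at most [p], so that their absolute
    sum is at most [p] as well, and the weight [prod_t expR (- |u_t|)] is at
    least [expR (- p)].  The lattice sum of these weights therefore bounds the
    number of points.  A large [M] makes the mesh of the lattice at most 1 in
    every coordinate. *)
Lemma prod_dist_le_cover (p : nat) (S : set V) (h : nat -> V) (delta : nat -> R)
    (r : R) (x : 'I_(2 ^ p) -> V) :
  (0 < p)%N -> 0 < r ->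
  (forall t, (t < p)%N -> 0 < delta t) ->
  (forall t (c : nat -> R), (t < p)%N ->
     delta t <= `|h t - \sum_(l < t) c l *: h l|) ->
  (forall c : 'I_p -> R, \sum_i `|c i| <= 1 -> S (\sum_i c i *: h i)) ->
  S `<=` \bigcup_i ball (x i) r ->
  \prod_(t < p) delta t <= (4 * expR 1 ^+ 2 * r * Num.sqrt p%:R) ^+ p.
Proof.
move=> p0 r0 d0 hd hS cov.
have [e [e1 e2 e3]] := gram_schmidt dot dot_norm p h delta d0 hd.
pose q : R := Num.sqrt p%:R.
have q0 : 0 < q by rewrite sqrtr_gt0 ltr0n.
have qq : q * q = p%:R by rewrite -expr2 sqr_sqrtr.
have pR : 0 < p%:R :> R by rewrite ltr0n.
have dt t : (t < p)%N -> 0 < dot (e t) (h t).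
  by move=> tp; apply: lt_le_trans (d0 t tp) (e3 t tp).
pose X := \sum_(t < p) dot (e t) (h t) / (r * q).
have X0 : 0 <= X.
  by apply: sumr_ge0 => t _; rewrite divr_ge0 // ltW ?dt ?mulr_gt0.
have [M MX M0] : exists2 M : nat, X <= M%:R & (0 < M)%N.
  exists (Num.bound X); first exact: ltW (archi_boundP X0).
  by rewrite -(@ltr0n R); apply: le_lt_trans (archi_boundP X0).
have MR : 0 < M%:R :> R by rewrite ltr0n.
pose y (k : {ffun 'I_p -> 'I_M}) := \sum_(l < p) ((k l)%:R / (p%:R * M%:R)) *: h l.
pose A (t l : nat) : R := q / (r * (p%:R * M%:R)) * dot (e t) (h l).
pose s (b : 'I_(2 ^ p)) (t : nat) := - (q / r * dot (e t) (x b)).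
pose phi (z : R) := expR (- `|z|).
have uE (k : {ffun 'I_p -> 'I_M}) b t : \sum_(l < p) A t l * (k l)%:R + s b t = q / r * dot (e t) (y k - x b).
  rewrite linearBr mulrBr /= /s; congr (_ - _).
  rewrite linear_sumr mulr_sumr; apply: eq_bigr => l _ /=.
  rewrite (dotZr dot) /A; field.
  by rewrite !gt_eqF.
have Sy k : S (y k).
  apply: (hS (fun l => (k l)%:R / (p%:R * M%:R))).
  apply: (@le_trans _ _ (\sum_(i < p) p%:R^-1)); last first.
    by rewrite sumr_const card_ord -[_ *+ p]mulr_natl mulfV ?gt_eqF.
  apply: ler_sum => l _; rewrite ger0_norm; last by rewrite divr_ge0 ?mulr_ge0 ?ler0n.
  rewrite ler_pdivrMr ?mulr_gt0 // mulrA mulVf ?gt_eqF // mul1r ler_nat.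
  exact: ltnW (ltn_ord _).
have one_le (k : {ffun 'I_p -> 'I_M}) : 1 <= \sum_b expR 1 ^+ p *
     \prod_(t < p) phi (\sum_(l < p) A t l * (k l)%:R + s b t).
  have [b _ yb] := cov _ (Sy k).
  rewrite (bigD1 b) //= -[leLHS]addr0; apply: lerD; last first.
    apply: sumr_ge0 => b' _; rewrite mulr_ge0 ?exprn_ge0 ?expR_ge0 //.
    by apply: prodr_ge0 => t _; exact: expR_ge0.
  have nyx : `|y k - x b| ^+ 2 <= r ^+ 2.
    rewrite lerXn2r ?nnegrE ?(ltW r0) //.
    by move: yb; rewrite -ball_normE /= distrC => /ltW.
  (* [|u| <= 1 / 2 + u ^ 2 / 2], summed with the help of Bessel's inequality. *)
  have sumu : \sum_(t < p) `|\sum_(l < p) A t l * (k l)%:R + s b t| <= p%:R.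
    apply: (@le_trans _ _ (\sum_(t < p)
       (2^-1 + (q / r) ^+ 2 / 2 * (dot (e t) (y k - x b)) ^+ 2))).
      apply: ler_sum => t _; rewrite uE.
      set u := q / r * _.
      have -> : (q / r) ^+ 2 / 2 * (dot (e t) (y k - x b)) ^+ 2 = `|u| ^+ 2 / 2.
        by rewrite real_normK ?num_real // /u; field; rewrite gt_eqF.
      have := sqr_ge0 (`|u| - 1); rewrite sqrrB; lra.
    rewrite big_split /= sumr_const card_ord -mulr_sumr.
    have bes := le_trans (bessel dot dot_norm p e (y k - x b) e1) nyx.
    have c0 : 0 <= (q / r) ^+ 2 / 2 by rewrite divr_ge0 ?sqr_ge0.
    have := ler_wpM2l c0 bes.
    have -> : (q / r) ^+ 2 / 2 * r ^+ 2 = p%:R / 2.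
      by rewrite -qq; field; rewrite gt_eqF.
    rewrite -[2^-1 *+ p]mulr_natl; lra.
  have -> : expR 1 ^+ p = expR p%:R :> R by rewrite -expRM_natl mulr1.
  by rewrite /phi -expR_sum -expRD -[leLHS]expR0 ler_expR sumrN subr_ge0.
have tot : (M%:R ^+ p : R) <= \sum_(b < 2 ^ p) expR 1 ^+ p * \prod_(t < p) (2 * expR 1 / A t t).
  apply: (@le_trans _ _ (\sum_(k : {ffun 'I_p -> 'I_M}) 1)).
    by rewrite sumr_const card_ffun !card_ord natrX.
  apply: le_trans (ler_sum _ (fun k _ => one_le k)) _.
  rewrite exchange_big; apply: ler_sum => b _ /=.
  rewrite -mulr_sumr; apply: ler_wpM2l; first by rewrite exprn_ge0 ?expR_ge0.
  apply: (sum_prod_triangular R p M phi A (s b) (fun t => 2 * expR 1 / A t t)).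
  - by move=> z; exact: expR_ge0.
  - move=> t z tp; apply: expR_sum_lattice.
      by rewrite /A mulr_gt0 ?dt // divr_gt0 // !mulr_gt0.
    have -> : A t t = dot (e t) (h t) / (r * q) / M%:R.
      rewrite /A -qq; field.
      by rewrite !gt_eqF.
    rewrite ler_pdivrMr // mul1r; apply: le_trans MX.
    rewrite /X (bigD1 (Ordinal tp)) //= lerDl.
    by apply: sumr_ge0 => l _; rewrite divr_ge0 // ltW ?dt ?mulr_gt0.
  - by move=> t l lt tp; rewrite /A e2 // mulr0.
rewrite sumr_const card_ord -[leRHS]mulr_natl natrX mulrA -exprMn in tot.
apply: (@le_trans _ _ (\prod_(t < p) dot (e t) (h t))).
  by apply: ler_prod => t _; rewrite ltW ?d0 //= e3.
rewrite -(ler_pM2r (exprn_gt0 p MR)).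
have D0 : 0 <= \prod_(t < p) dot (e t) (h t).
  by apply: prodr_ge0 => t _; rewrite ltW ?dt.
apply: le_trans (ler_wpM2l D0 tot) _.
rewrite mulrCA -big_split /=.
rewrite (eq_bigr (fun=> 2 * expR 1 * r * q * M%:R)); last first.
  move=> t _; rewrite /A -qq; field.
  by rewrite !gt_eqF //= dt.
rewrite prodr_const card_ord -!exprMn le_eqVlt; apply/orP; left.
by apply/eqP; congr (_ ^+ _); rewrite /q; ring.
Qed.

Lemma sym_convex_hull_fin (I : finType) (K : set V) (c : I -> R) (g : I -> V) :
  (forall i, K (g i)) -> \sum_i `|c i| <= 1 ->
  sym_convex_hull K (\sum_i c i *: g i).
Proof.
move=> Kg c1; apply: subset_closure.
have hb := onW_bij xpredT (enum_val_bij I).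
rewrite (reindex _ hb) /= in c1; rewrite (reindex _ hb) /=.
by exists #|I|, (fun i => c (enum_val i)), (fun i => g (enum_val i)); split.
Qed.

(** The hull contains the segment from 0 to [g].  Of [2 ^ n + 1] equidistant
    points on it, two lie in the same ball. *)
Lemma entropy_number_gt0 (n : nat) (K : set V) (g : V) :
  K g -> g != 0 -> (0 < entropy_number n (sym_convex_hull K))%E.
Proof.
move=> Kg g0.
have ng : 0 < `|g| by rewrite normr_gt0.
pose N := (2 ^ n)%N.
have N0 : (0 < N)%N by rewrite expn_gt0.
have NR : 0 < N%:R :> R by rewrite ltr0n.
apply: (@lt_le_trans _ _ (`|g| / (2 * N%:R))%:E).
  by rewrite lte_fin divr_gt0 // mulr_gt0.
apply: le_ereal_inf_tmp => _ [r [r0 [x cov]] <-]; rewrite lee_fin.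
have inS (k : 'I_N.+1) : sym_convex_hull K ((k%:R / N%:R) *: g).
  have := sym_convex_hull_fin 'I_1 K (fun=> k%:R / N%:R) (fun=> g) (fun=> Kg).
  rewrite !big_ord1; apply.
  rewrite ger0_norm ?divr_ge0 // ler_pdivrMr // mul1r ler_nat.
  by rewrite -ltnS.
have /choice [b hb] : forall k : 'I_N.+1, exists b, ball (x b) r ((k%:R / N%:R) *: g).
  by move=> k; have [b _ hb] := cov _ (inS k); exists b.
have /injectivePn [k [l kl bkl]] : ~~ injectiveb b.
  apply/negP => /injectiveP binj.
  by have := leq_card b binj; rewrite !card_ord ltnn.
have := hb l; have := hb k; rewrite bkl -ball_normE /= distrC => bk bl.
have : `|(k%:R / N%:R) *: g - (l%:R / N%:R) *: g| < r + r.
  rewrite -(subrKA (x (b l))); apply: le_lt_trans (ler_normD _ _) _.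
  exact: ltrD.
rewrite -scalerBl normrZ -mulrBl normrM normfV (ger0_norm (ltW NR)).
have : 1 <= `|k%:R - l%:R : R|.
  have [kl'|lk|/val_inj klE] := ltngtP k l.
  - by rewrite distrC -natrB ?(ltnW kl') // normr_nat ler1n subn_gt0.
  - by rewrite -natrB ?(ltnW lk) // normr_nat ler1n subn_gt0.
  - by rewrite klE eqxx in kl.
set D := `|_ - _| => D1 hr.
rewrite ler_pdivrMr ?mulr_gt0 //.
have : D / N%:R * `|g| * N%:R < (r + r) * N%:R by rewrite ltr_pM2r.
have -> : D / N%:R * `|g| * N%:R = D * `|g| by field; rewrite gt_eqF.
nra.
Qed.

End Entropy.

(** * The largest eigenvalue of the correlation operator *)

(** The trace is the sum of the eigenvalues, so that one of them is at least the
    average.  Diagonalisation takes place over the complex numbers, where the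
    eigenvalues of a real symmetric matrix are real. *)
Lemma sym_mx_large_eigenvalue (R : realType) (n : nat) (A : 'M[R]_n.+1) :
  A^T = A -> exists2 mu : R, eigenvalue A mu & \tr A <= n.+1%:R * mu.
Proof.
move=> Asym.
pose f : {rmorphism R -> R[i]} := real_complex R.
pose B := map_mx f A.
have Bsym : B \is symmetricmx.
  by apply/is_hermitianmxP; rewrite expr0 scale1r map_mx_id // map_trmx Asym.
have Breal : B \is a realmx.
  by apply/mxOverP => i j; rewrite mxE; apply/complex_realP; exists (A i j).
have Bherm := realsym_hermsym Bsym Breal.
have /hermitian_normalmx /orthomx_spectralP := Bherm.
set P := spectralmx B; set sp := spectral_diag B => BE.
have Punit : P \in unitmx by exact: spectral_unit.
have spR i : sp 0 i = f (complex.Re (sp 0 i)).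
  by apply/esym/RRe_real; apply: (mxOverP (hermitian_spectral_diag_real Bherm)).
have PB : P *m B = diag_mx sp *m P by rewrite {1}BE !mulmxA mulmxV // mul1mx.
have eig i : eigenvalue A (complex.Re (sp 0 i)).
  rewrite eigenvalue_root_char -(fmorph_root f) -spR map_char_poly.
  rewrite -eigenvalue_root_char; apply/eigenvalueP; exists (row i P).
    by rewrite -row_mul PB row_mul row_diag_mx -scalemxAl -rowE.
  apply/eqP => P0; have := mulmxV Punit => /(congr1 (row i)).
  rewrite row_mul P0 mul0mx => /rowP /(_ i) /eqP.
  by rewrite !mxE eqxx eq_sym oner_eq0.
have trE : \tr A = \sum_i complex.Re (sp 0 i).
  apply: (fmorph_inj f).
  rewrite [RHS]rmorph_sum [RHS](eq_bigr (sp 0)); last first.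
    by move=> i _; exact: esym (spR i).
  rewrite -mxtrace_diag -(mulmxK Punit (diag_mx sp)) -PB mxtrace_mulC mulmxA.
  by rewrite mulVmx // mul1mx /B trace_map_mx.
have [[i hi]|none] := pselect (exists i : 'I_n.+1, \tr A <= n.+1%:R * complex.Re (sp 0 i)).
  by exists (complex.Re (sp 0 i)).
exfalso; suff : \sum_(i < n.+1) n.+1%:R * complex.Re (sp 0 i) < \sum_(i < n.+1) \tr A.
  by rewrite -mulr_sumr -trE sumr_const card_ord mulr_natl ltxx.
apply: ltr_sum; first by apply/hasP; exists ord0; rewrite ?mem_index_enum.
by move=> i _; rewrite ltNge; apply/negP => hi; apply: none; exists i.
Qed.

(** The left-hand side is the trace of the Gram matrix [G] of [r], weighted by
    [tau].  A left eigenvector [v] of [G] gives the eigenvector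
    [sum_j v_j r_j] of the correlation operator, with the same eigenvalue.  If
    the inequality failed, [G] would have an eigenvalue above [lam 1], whose
    eigenspace is of dimension 0 by the maximality of the listed eigenvalues. *)
Lemma dotT_le_eigval1 (R : realType) (V : lmodType R)
    (dot : {dot V for (@idfun R)}) (T : R) (J m : nat)
    (r : 'I_J.+1 -> V) (lam : nat -> R) (f : nat -> V) :
  (0 < m)%N -> 0 < lam 1%N ->
  leading_eigenpairs dot (correlation dot T r) m lam f ->
  dotT dot T r r <= J.+1%:R * lam 1%N.
Proof.
move=> m0 l0 [_ _ lmono lead]; rewrite leNgt; apply/negP => big.
pose G : 'M[R]_J.+1 := \matrix_(i, j) (tau T J * dot (r i) (r j)).
have Gsym : G^T = G.
  by apply/matrixP => i j; rewrite !mxE (dotC dot).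
have [mu /eigenvalueP [v vG v0] trG] := sym_mx_large_eigenvalue R J G Gsym.
have lmu : lam 1%N < mu.
  rewrite -(@ltr_pM2l _ J.+1%:R) ?ltr0n //; apply: lt_le_trans big _.
  by apply: le_trans trG; rewrite le_eqVlt; apply/orP; left; apply/eqP;
     apply: eq_bigr => i _; rewrite mxE.
pose w := \sum_j v 0 j *: r j.
have wj j : tau T J * dot (r j) w = mu * v 0 j.
  have -> : mu * v 0 j = (v *m G) 0 j by rewrite vG mxE.
  rewrite mxE linear_sumr mulr_sumr; apply: eq_bigr => l _ /=.
  by rewrite mxE (dotC dot (r l)) (dotZr dot) mulrCA.
have w0 : w != 0.
  apply: contra v0 => /eqP w0; apply/eqP/rowP => j; rewrite mxE.
  have := wj j; rewrite w0 linear0r mulr0 => /esym/eqP.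
  by rewrite mulf_eq0 gt_eqF ?(lt_trans l0 lmu) //= => /eqP.
have wE : correlation dot T r w = mu *: w.
  rewrite /correlation scaler_sumr; apply: eq_bigr => j _.
  by rewrite wj scalerA.
have lmm : lam m < mu by apply: le_lt_trans lmu; exact: lmono.
have [g [_ spanE]] := lead mu lmm.
have none : count (fun k => lam k == mu) (iota 1 m) = 0%N.
  apply/eqP; rewrite -leqn0 leqNgt -has_count; apply/hasPn => k.
  rewrite mem_iota add1n ltnS => /andP[k1 km].
  by rewrite lt_eqF // (le_lt_trans _ lmu) // lmono.
have : eigenspace_of (correlation dot T r) mu w by [].
rewrite spanE => -[q [c [h [hg wc]]]].
move: w0; rewrite wc big1 ?eqxx // => i _.
by have [[k kn] _ _] := hg i; exfalso; move: kn; rewrite none.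
Qed.

(** * Linear spans and empirical interpolation *)

Section LinSpan.
Context {R : realType} {V : lmodType R}.
Implicit Types (A S : set V) (u v : V).

Definition subspace S := S 0 /\ forall (c : R) u v, S u -> S v -> S (c *: u + v).

Lemma subspaceD S u v : subspace S -> S u -> S v -> S (u + v).
Proof. by move=> [_ SP] Su Sv; rewrite -[u]scale1r; exact: SP. Qed.

Lemma subspaceZ S (c : R) u : subspace S -> S u -> S (c *: u).
Proof. by move=> [S0 SP] Su; rewrite -[_ *: _]addr0; exact: SP. Qed.

Lemma subspaceB S u v : subspace S -> S u -> S v -> S (u - v).
Proof. by move=> [_ SP] Su Sv; rewrite addrC -scaleN1r; exact: SP. Qed.

Lemma subspace_sum S (I : finType) (c : I -> R) (g : I -> V) :
  subspace S -> (forall i, S (g i)) -> S (\sum_i c i *: g i).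
Proof.
move=> sS Sg; elim/big_ind: _ => [|u v|i _]; first by case: sS.
  exact: subspaceD.
exact: subspaceZ.
Qed.

Lemma lin_span_fin A (I : finType) (c : I -> R) (g : I -> V) :
  (forall i, A (g i)) -> lin_span A (\sum_i c i *: g i).
Proof.
move=> Ag; have hb := onW_bij xpredT (enum_val_bij I).
rewrite (reindex _ hb) /=.
by exists #|I|, (fun i => c (enum_val i)), (fun i => g (enum_val i)).
Qed.

Lemma subspace_lin_span A : subspace (lin_span A).
Proof.
split; first by exists 0%N, (fun=> 0), (fun=> 0); rewrite big_ord0; split=> // -[].
move=> c _ _ [p [c1 [g1 [A1 ->]]]] [q [c2 [g2 [A2 ->]]]].
pose C (i : 'I_p + 'I_q) := match i with inl i => c * c1 i | inr i => c2 i end.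
pose G (i : 'I_p + 'I_q) := match i with inl i => g1 i | inr i => g2 i end.
have := @lin_span_fin A _ C G; rewrite big_sumType /= scaler_sumr.
under [in X in X -> _]eq_bigr do rewrite -scalerA.
by apply; case.
Qed.

Lemma lin_span_sub A S : subspace S -> A `<=` S -> lin_span A `<=` S.
Proof.
by move=> sS AS _ [p [c [g [Ag ->]]]]; apply: subspace_sum => // i; exact: AS.
Qed.

Lemma lin_span_gen A : A `<=` lin_span A.
Proof.
move=> v Av; have := @lin_span_fin A 'I_1 (fun=> 1) (fun=> v) (fun=> Av).
by rewrite big_ord1 scale1r.
Qed.

End LinSpan.

Section Interpolation.
Context {R : realType} {V : completeNormedModType R} {Omega : Type} {d : nat}.
Context {Sigma : set Omega} (ev : evaluation V Sigma) (D : eim_data R V Omega d).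

Lemma subspace_evaluable : subspace (evaluable ev).
Proof. by split; [exact: evaluable0|exact: evaluableP]. Qed.

Lemma eval0 y : Sigma y -> ev 0 y = 0.
Proof.
move=> Sy; have := evalP 1 (evaluable0 ev) (evaluable0 ev) Sy.
rewrite scaler0 addr0 mul1r => e.
by apply: (addrI (ev 0 y)); rewrite addr0 -e.
Qed.

(** Evaluation is linear on the evaluable elements only, so linearity and
    evaluability have to be established together. *)
Lemma eval_sum (I : finType) (c : I -> R) (g : I -> V) y : Sigma y ->
  (forall i, evaluable ev (g i)) ->
  ev (\sum_i c i *: g i) y = \sum_i c i * ev (g i) y.
Proof.
move=> Sy eg.
suff [] : evaluable ev (\sum_i c i *: g i) /\
  ev (\sum_i c i *: g i) y = \sum_i c i * ev (g i) y by [].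
apply: (big_ind2 (fun (u : V) x => evaluable ev u /\ ev u y = x)).
- by split; [exact: evaluable0|exact: eval0].
- move=> u x v z [eu <-] [ev' <-]; rewrite -[u]scale1r.
  by split; [exact: evaluableP|rewrite evalP // scale1r mul1r].
- move=> i _; rewrite -[_ *: _]addr0; split.
    by apply: evaluableP => //; exact: evaluable0.
  rewrite evalP ?eval0 ?addr0 //; exact: evaluable0.
Qed.

Definition interp_space (p : nat) : set V :=
  lin_span [set v | exists2 t, (t < p)%N & v = bas D t.+1].

Lemma interp_space_mono p q : (p <= q)%N -> interp_space p `<=` interp_space q.
Proof.
move=> pq; apply: lin_span_sub; first exact: subspace_lin_span.
move=> _ [t tp ->]; apply: lin_span_gen; exists t => //; exact: leq_trans pq.
Qed.

Lemma interp_in_space p g : interp_space p (interp ev D p g).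
Proof. by apply: lin_span_fin => i; exists i. Qed.

(** The invariant of the construction: the interpolation matrix is lower
    triangular with unit diagonal, because the residual that defines a basis
    function vanishes at the earlier points. *)
Definition triangular_basis (p : nat) := forall t, (t < p)%N ->
  [/\ evaluable ev (bas D t.+1), Sigma (pt D t.+1),
      ev (bas D t.+1) (pt D t.+1) = 1 &
      forall i, (i < t)%N -> ev (bas D t.+1) (pt D i.+1) = 0].

Lemma interp_mx_unit p : triangular_basis p -> interp_mx ev D p \in unitmx.
Proof.
move=> tri; rewrite unitmxE det_trig.
  rewrite big1 ?unitr1 // => i _; rewrite mxE.
  by have [] := tri i (ltn_ord i).
apply/is_trig_mxP => i j ij; rewrite mxE.
by have [_ _ _ ->] := tri j (ltn_ord j).
Qed.

Lemma interp_space_evaluable p : triangular_basis p ->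
  interp_space p `<=` evaluable ev.
Proof.
move=> tri; apply: lin_span_sub; first exact: subspace_evaluable.
by move=> _ [t tp ->]; have [] := tri t tp.
Qed.

Lemma eval_interp p g i : triangular_basis p -> (i < p)%N ->
  ev (interp ev D p g) (pt D i.+1) = ev g (pt D i.+1).
Proof.
move=> tri ip; rewrite eval_sum; last 2 first.
- by have [] := tri i ip.
- by move=> j; have [] := tri j (ltn_ord j).
set F := \col_(i < p) _.
have : (interp_mx ev D p *m (invmx (interp_mx ev D p) *m F)) (Ordinal ip) 0
  = F (Ordinal ip) 0 by rewrite mulKVmx // interp_mx_unit.
rewrite [in RHS]mxE mxE => <-; apply: eq_bigr => j _.
by rewrite [interp_mx _ _ _ _ _]mxE mulrC.
Qed.

Lemma interpP p (c : R) f g : triangular_basis p ->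
  evaluable ev f -> evaluable ev g ->
  interp ev D p (c *: f + g) = c *: interp ev D p f + interp ev D p g.
Proof.
move=> tri ef eg; rewrite /interp scaler_sumr -big_split /=.
have -> : \col_(i < p) ev (c *: f + g) (pt D i.+1) =
    c *: (\col_(i < p) ev f (pt D i.+1)) + \col_(i < p) ev g (pt D i.+1).
  apply/colP => i; rewrite !mxE evalP //.
  by have [] := tri i (ltn_ord i).
apply: eq_bigr => j _.
by rewrite mulmxDr -scalemxAr mxE [in LHS]mxE scalerDl scalerA.
Qed.

Lemma interp0 p : triangular_basis p -> interp ev D p 0 = 0.
Proof.
move=> tri; have := interpP p 1 0 0 tri (evaluable0 ev) (evaluable0 ev).
rewrite scaler0 addr0 scale1r => e.
by apply: (addrI (interp ev D p 0)); rewrite addr0 -e.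
Qed.

Lemma interpB p f g : triangular_basis p -> evaluable ev f -> evaluable ev g ->
  interp ev D p (f - g) = interp ev D p f - interp ev D p g.
Proof. by move=> tri ef eg; rewrite addrC -scaleN1r interpP // scaleN1r addrC. Qed.

Lemma interp_id p v : triangular_basis p -> interp_space p v ->
  interp ev D p v = v.
Proof.
move=> tri; pose S := [set v | evaluable ev v /\ interp ev D p v = v].
suff sub : interp_space p `<=` S by move=> /sub [].
apply: lin_span_sub.
  split; first by split; [exact: evaluable0|exact: interp0].
  move=> c u w [eu iu] [ew iw]; split; first exact: evaluableP.
  by rewrite interpP // iu iw.
move=> _ [t tp ->]; split; first by have [] := tri t tp.
rewrite /interp.
have -> : \col_(i < p) ev (bas D t.+1) (pt D i.+1) =
  interp_mx ev D p *m delta_mx (Ordinal tp) 0.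
  by rewrite -colE; apply/colP => i; rewrite !mxE.
rewrite mulKmx ?interp_mx_unit // (bigD1 (Ordinal tp)) //= mxE !eqxx scale1r.
rewrite big1 ?addr0 // => j jt.
by rewrite mxE (negbTE jt) scale0r.
Qed.

(** A function and its interpolant agree at the interpolation points, and the
    interpolant is reproduced by interpolation. *)
Lemma interp_residual p g : triangular_basis p -> evaluable ev g ->
  interp ev D p (g - interp ev D p g) = 0.
Proof.
move=> tri eg; rewrite interpB //.
  by rewrite (interp_id _ _ tri (interp_in_space p g)) subrr.
exact: interp_space_evaluable tri _ (interp_in_space p g).
Qed.

Lemma triangular_basisS p (f : V) :
  let r := f - interp ev D p f in
  triangular_basis p -> evaluable ev f -> Sigma (pt D p.+1) ->
  ev r (pt D p.+1) != 0 -> bas D p.+1 = (ev r (pt D p.+1))^-1 *: r ->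
  triangular_basis p.+1.
Proof.
move=> r tri ef Sp r0 bE t; rewrite ltnS leq_eqVlt => /predU1P[->|]; last exact: tri.
have ei := interp_space_evaluable p tri _ (interp_in_space p f).
have er : evaluable ev r by apply: subspaceB => //; exact: subspace_evaluable.
have evZ c y : Sigma y -> ev (c *: r) y = c * ev r y.
  move=> Sy; rewrite -[c *: r]addr0 evalP ?eval0 ?addr0 //; exact: evaluable0.
split=> //.
- by rewrite bE; apply: subspaceZ => //; exact: subspace_evaluable.
- by rewrite bE evZ // mulVf.
- move=> i ip; have [_ Si _ _] := tri i ip.
  have ri : r = (-1) *: interp ev D p f + f by rewrite /r addrC scaleN1r.
  by rewrite bE evZ // {2}ri evalP // eval_interp // mulN1r addNr mulr0.
Qed.

End Interpolation.

(** * The greedy iteration *)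

(** Iterations and modes are numbered from 0: iteration [b + 1] starts from [V_b],
    which is [W (b * m)], and basis function [t + 1] comes from mode [t %% m] of
    iteration [t %/ m].  The real numbers [L b] are bounds for the norms of the
    interpolation operators on the span of the slices. *)
Section Greedy.
Context {R : realType} {V : completeNormedModType R}.
Context {dot : {dot V for (@idfun R)}} {T : R} {J m : nat}.
Context {Omega : Type} {Sigma : set Omega} {ev : evaluation V Sigma} {d : nat}.
Context {P : set 'rV[R]_d} {a : 'rV[R]_d -> 'I_J.+1 -> V} {D : eim_data R V Omega d}.
Context {N n : nat} {L : nat -> R}.
Hypothesis dot_norm : forall v : V, dot v v = `|v| ^+ 2.
Hypothesis tau_gt0 : 0 < tau T J.
Hypothesis m_gt0 : (0 < m)%N.
Hypothesis greedy : eim_pod_greedy dot T m ev P a D N.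
Hypothesis n_le : (n <= N)%N.
Hypothesis eigval_gt0 : forall b, (b < n)%N -> 0 < eigval D b.+1 m.
Hypothesis L_ge0 : forall b, (b < n)%N -> 0 <= L b.
Hypothesis L_bound : forall b v, (b < n)%N -> lin_span (slices P a) v ->
  `|Pi m ev D b v| <= L b * `|v|.

Local Notation S := (lin_span (slices P a)).
Local Notation W := (interp_space D).
Local Notation r b := (residualT m ev a D b.+1 (sel D b.+1)).
Local Notation f b k := (eigvec D b.+1 k.+1).
Local Notation lam b k := (eigval D b.+1 k.+1).
Local Notation coef b k j := (tau T J * dot (r b j) (f b k)).

Lemma greedy_stepP b : (b < n)%N -> greedy_step dot T m ev P a D b.+1.
Proof. by move=> bn; case: greedy => _; apply; rewrite (leq_trans bn). Qed.

Lemma slices_evaluable mu j : P mu -> evaluable ev (a mu j).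
Proof. by case: greedy => + _; apply. Qed.

Lemma divn_block t : (t < n * m)%N -> (t %/ m < n)%N.
Proof. by move=> tn; rewrite ltn_divLR. Qed.

Lemma greedy_interp_step t (b := (t %/ m)%N) (k := (t %% m)%N)
    (g := f b k - interp ev D t (f b k)) : (t < n * m)%N ->
  [/\ evaluable ev (f b k), Sigma (pt D t.+1), ev g (pt D t.+1) != 0 &
      bas D t.+1 = (ev g (pt D t.+1))^-1 *: g].
Proof.
move=> tn; have bn := divn_block t tn.
have [_ _ _ /(_ k.+1)] := greedy_stepP b bn.
rewrite /interp_step /residual /= addnS -divn_eq ltn_mod m_gt0.
by case=> // ? ? _ ? ?; split.
Qed.

Lemma greedy_triangular p : (p <= n * m)%N -> triangular_basis ev D p.
Proof.
elim: p => [|p IH] pn; first by [].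
have [e1 e2 e3 e4] := greedy_interp_step p pn.
by apply: triangular_basisS e4 => //; apply: IH; exact: ltnW.
Qed.

Lemma block_triangular b : (b <= n)%N -> triangular_basis ev D (b * m).
Proof. by move=> bn; apply: greedy_triangular; rewrite leq_mul2r bn orbT. Qed.

Lemma span_slices_evaluable : S `<=` evaluable ev.
Proof.
apply: lin_span_sub; first exact: subspace_evaluable.
by move=> _ [mu Pmu [j ->]]; exact: slices_evaluable.
Qed.

Lemma Pi_residual b mu j : (b <= n)%N -> P mu ->
  Pi m ev D b (residualT m ev a D b.+1 mu j) = 0.
Proof.
move=> bn Pmu; rewrite /residualT /PiT /=.
by apply: interp_residual; [exact: block_triangular|exact: slices_evaluable].
Qed.

Lemma eigval_pos b k : (b < n)%N -> (k < m)%N -> 0 < lam b k.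
Proof.
move=> bn km; have [_ _ [_ _ mono _] _] := greedy_stepP b bn.
by apply: lt_le_trans (eigval_gt0 b bn) _; exact: mono.
Qed.

Lemma correlation_eigvec b k : (b < n)%N -> (k < m)%N ->
  \sum_j coef b k j *: r b j = lam b k *: f b k.
Proof.
move=> bn km; have [_ _ [eig _ _ _] _] := greedy_stepP b bn.
exact: eig.
Qed.

Lemma eigvecE b k : (b < n)%N -> (k < m)%N ->
  f b k = \sum_j ((lam b k)^-1 * coef b k j) *: r b j.
Proof.
move=> bn km; under eq_bigr do rewrite -scalerA.
rewrite -scaler_sumr correlation_eigvec // scalerA mulVf ?scale1r //.
by rewrite gt_eqF ?eigval_pos.
Qed.

Lemma slice_in_span mu j : P mu -> S (a mu j).
Proof. by move=> Pmu; apply: lin_span_gen; exists mu => //; exists j. Qed.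

Lemma sel_in b : (b < n)%N -> P (sel D b.+1).
Proof. by move=> bn; case: (greedy_stepP b bn). Qed.

Lemma residual_in_span b j : (b < n)%N -> W (b * m) `<=` S -> S (r b j).
Proof.
move=> bn WS; apply: subspaceB; first exact: subspace_lin_span.
  exact/slice_in_span/sel_in.
by apply: WS; exact: interp_in_space.
Qed.

(** The eigenvectors belong to the span of the slices as their eigenvalues do
    not vanish.  This is what makes the bounds [L b], which hold on that span
    alone, applicable to the basis functions. *)
Lemma interp_space_in_span p : (p <= n * m)%N -> W p `<=` S.
Proof.
elim: p => [|p IH] pn.
  apply: lin_span_sub; first exact: subspace_lin_span.
  by move=> v [t].
have WS := IH (ltnW pn).
apply: lin_span_sub; first exact: subspace_lin_span.
move=> _ [t tp ->]; move: tp; rewrite ltnS leq_eqVlt => /predU1P[->|tp]; last first.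
  by apply: WS; apply: lin_span_gen; exists t.
have [_ _ _ ->] := greedy_interp_step p pn.
have bn := divn_block p pn.
apply: subspaceZ; first exact: subspace_lin_span.
apply: subspaceB; first exact: subspace_lin_span.
  rewrite eigvecE ?ltn_mod //.
  apply: subspace_sum; first exact: subspace_lin_span.
  move=> j; apply: residual_in_span => //.
  by apply: subset_trans WS; apply: interp_space_mono; exact: leq_trunc_div.
by apply: WS; exact: interp_in_space.
Qed.

Lemma block_in_span b : (b <= n)%N -> W (b * m) `<=` S.
Proof. by move=> bn; apply: interp_space_in_span; rewrite leq_mul2r bn orbT. Qed.

Lemma eigvec_in_span b k : (b < n)%N -> (k < m)%N -> S (f b k).
Proof.
move=> bn km; rewrite eigvecE //; apply: subspace_sum.
  exact: subspace_lin_span.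
by move=> j; apply: residual_in_span => //; apply: block_in_span; exact: ltnW.
Qed.

Lemma Pi_ker_subspace b : (b <= n)%N ->
  subspace [set v | S v /\ Pi m ev D b v = 0].
Proof.
move=> bn; have tri := block_triangular b bn.
split; first by split; [case: (subspace_lin_span (slices P a))|exact: interp0].
move=> c u v [Su u0] [Sv v0]; split; first by case: (subspace_lin_span (slices P a)) => _; apply.
rewrite /Pi interpP; [|exact: tri|exact: span_slices_evaluable..].
by move: u0 v0; rewrite /Pi => -> ->; rewrite scaler0 addr0.
Qed.

Lemma Pi_eigvec b k : (b < n)%N -> (k < m)%N -> Pi m ev D b (f b k) = 0.
Proof.
move=> bn km; have bn' := ltnW bn.
suff [] : S (f b k) /\ Pi m ev D b (f b k) = 0 by [].
rewrite {1 2}eigvecE //.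
apply: (subspace_sum _ _ _ _ (Pi_ker_subspace b bn')) => j; split.
  by apply: residual_in_span => //; exact: block_in_span.
by apply: Pi_residual => //; exact: sel_in.
Qed.

(** A projection error is at most the best-approximation error times one plus the
    norm of the projection: apply the identity minus [Pi_b] to [u - w], as
    [Pi_b] fixes [w].  This serves twice, for the comparison of errors of
    different iterations and for the distance of the eigenvectors from [V_b]. *)
Lemma interp_error_le b u w : (b < n)%N -> S u -> W (b * m) w ->
  `|u - Pi m ev D b u| <= (1 + L b) * `|u - w|.
Proof.
move=> bn Su Ww; have tri := block_triangular b (ltnW bn).
have Sw := block_in_span b (ltnW bn) w Ww.
have Suw : S (u - w) by apply: subspaceB => //; exact: subspace_lin_span.
have -> : u - Pi m ev D b u = (u - w) - Pi m ev D b (u - w).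
  rewrite {2}/Pi interpB //; try exact: span_slices_evaluable.
  by rewrite (interp_id _ _ _ _ tri Ww) -/(Pi m ev D b u) opprB addrA subrK.
rewrite mulrDl mul1r; apply: le_trans (ler_normB _ _) _.
by rewrite lerD2l L_bound.
Qed.

Lemma normT_le (c : R) (u v : 'I_J.+1 -> V) : 0 <= c ->
  (forall j, `|u j| <= c * `|v j|) -> normT dot T u <= c * normT dot T v.
Proof.
move=> c0 uv; have cE : c = Num.sqrt (c ^+ 2) by rewrite sqrtr_sqr ger0_norm.
rewrite /normT {1}cE -sqrtrM ?sqr_ge0 //; apply: ler_wsqrtr.
rewrite /dotT mulr_sumr; apply: ler_sum => j _.
rewrite mulrCA ler_wpM2l ?(ltW tau_gt0) // !dot_norm -exprMn.
by rewrite lerXn2r ?nnegrE ?mulr_ge0.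
Qed.

Lemma sigma_hatE b : (b < n)%N ->
  sigma_hat dot T m ev P a D b.+1 = (normT dot T (r b))%:E.
Proof. by move=> bn; case: (greedy_stepP b bn). Qed.

Lemma residual_norm_le_sel b mu : (b < n)%N -> P mu ->
  normT dot T (residualT m ev a D b.+1 mu) <= normT dot T (r b).
Proof.
move=> bn Pmu; rewrite -lee_fin -sigma_hatE //.
by apply: ereal_sup_ubound; exists mu.
Qed.

(** The interpolants of iteration [b + 1] lie in the larger space of iteration
    [b' + 1] and are competitors there for the best approximation. *)
Lemma residual_norm_le b b' : (b <= b')%N -> (b' < n)%N ->
  normT dot T (r b') <= (1 + L b') * normT dot T (r b).
Proof.
move=> bb bn; have L0 : 0 <= 1 + L b' by rewrite addr_ge0 ?L_ge0.
have Pmu := sel_in b' bn.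
apply: (@le_trans _ _ ((1 + L b') *
    normT dot T (residualT m ev a D b.+1 (sel D b'.+1)))); last first.
  apply: ler_wpM2l => //; apply: residual_norm_le_sel => //.
  exact: leq_ltn_trans bn.
apply: normT_le => // j; apply: interp_error_le => //; first exact: slice_in_span.
apply: interp_space_mono (interp_in_space _ _ _ _).
by rewrite leq_mul2r bb orbT.
Qed.

Lemma residual_norm_le_eigval b : (b < n)%N ->
  normT dot T (r b) <= Num.sqrt J.+1%:R * Num.sqrt (lam b 0).
Proof.
move=> bn; rewrite -sqrtrM //; apply: ler_wsqrtr.
have [_ _ lead _] := greedy_stepP b bn.
exact: dotT_le_eigval1 m_gt0 (eigval_pos b 0 bn m_gt0) lead.
Qed.

Lemma eigvec_orthonormal b k l : (b < n)%N -> (k < m)%N -> (l < m)%N ->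
  dot (f b k) (f b l) = (k == l)%:R.
Proof.
move=> bn km lm; have [_ _ [_ on _ _] _] := greedy_stepP b bn.
by rewrite on // eqSS.
Qed.

(** The coefficients of the eigenvalue equation of [f b k] have absolute sum at
   most [c0 * sqrt (lam b k)]. *)
Let c0 : R := J.+1%:R * Num.sqrt (tau T J).

Lemma c0_gt0 : 0 < c0.
Proof. by rewrite mulr_gt0 // sqrtr_gt0. Qed.

(** Taking the inner product of the eigenvalue equation with [f b k] shows that
    the numbers [tau <r_j, f> ^ 2] add up to [lam b k]. *)
Lemma coef_le b k j : (b < n)%N -> (k < m)%N ->
  `|coef b k j| <= Num.sqrt (tau T J) * Num.sqrt (lam b k).
Proof.
move=> bn km; rewrite -sqrtrM ?(ltW tau_gt0) // -sqrtr_sqr.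
apply: ler_wsqrtr; rewrite expr2 -mulrA ler_wpM2l ?(ltW tau_gt0) //.
have : dot (f b k) (lam b k *: f b k) = lam b k.
  by rewrite (dotZr dot) eigvec_orthonormal // eqxx mulr1.
rewrite -correlation_eigvec // linear_sumr /= => <-.
rewrite (bigD1 j) //= (dotZr dot) (dotC dot (f b k)) [leLHS]mulrC lerDl.
apply: sumr_ge0 => i _; rewrite (dotZr dot) (dotC dot (f b k)) -mulrA.
by rewrite mulr_ge0 ?(ltW tau_gt0) // -expr2 sqr_ge0.
Qed.

(** The eigenvalue equation of [f b k] with the residual slices replaced by the
    slices themselves, scaled so as to lie in the symmetric convex hull. *)
Definition pod_vec (b k : nat) : V :=
  (c0 * Num.sqrt (lam b k))^-1 *: \sum_j coef b k j *: a (sel D b.+1) j.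

Lemma pod_vec_coef b k : (b < n)%N -> (k < m)%N ->
  \sum_j `|(c0 * Num.sqrt (lam b k))^-1 * coef b k j| <= 1.
Proof.
move=> bn km; have s0 : 0 < Num.sqrt (lam b k) by rewrite sqrtr_gt0 eigval_pos.
have cs : 0 < c0 * Num.sqrt (lam b k) by rewrite mulr_gt0 ?c0_gt0.
under eq_bigr do rewrite normrM.
rewrite -mulr_sumr ger0_norm ?invr_ge0 ?(ltW cs) // ler_pdivrMl // mulr1.
apply: (@le_trans _ _ (\sum_(j < J.+1) Num.sqrt (tau T J) * Num.sqrt (lam b k))).
  by apply: ler_sum => j _; exact: coef_le.
by rewrite sumr_const card_ord -[_ *+ J.+1]mulr_natl mulrA.
Qed.

(** The residual slices differ from the slices by elements of [V_b], and
    [lam / (c0 sqrt lam) = sqrt lam / c0]. *)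
Lemma pod_vec_decomp b k : (b < n)%N -> (k < m)%N ->
  W (b * m) (pod_vec b k - (Num.sqrt (lam b k) / c0) *: f b k).
Proof.
move=> bn km; have s0 : 0 < Num.sqrt (lam b k) by rewrite sqrtr_gt0 eigval_pos.
have -> : Num.sqrt (lam b k) / c0 = (c0 * Num.sqrt (lam b k))^-1 * lam b k.
  rewrite -[in X in _ = _ * X](sqr_sqrtr (ltW (eigval_pos b k bn km))).
  by field; rewrite !gt_eqF ?c0_gt0.
rewrite -scalerA -correlation_eigvec // -scalerBr -sumrB.
apply: subspaceZ; first exact: subspace_lin_span.
under eq_bigr do rewrite -scalerBr opprB addrCA subrr addr0.
apply: subspace_sum; first exact: subspace_lin_span.
by move=> j; exact: interp_in_space.
Qed.

(** The sum of [V_b] and the span of the first [k] eigenvectors of iteration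
    [b + 1]; it contains all predecessors of [pod_vec b k]. *)
Definition flag (b k : nat) : set V := [set u | exists2 z,
  lin_span [set v | exists2 l, (l < k)%N & v = f b l] z & W (b * m) (u - z)].

Lemma subspace_flag b k : subspace (flag b k).
Proof.
pose F := [set v | exists2 l, (l < k)%N & v = f b l].
have [F0 FP] := subspace_lin_span F.
have [W0 WP] := subspace_lin_span [set v | exists2 t, (t < b * m)%N & v = bas D t.+1].
split; first by exists 0 => //; rewrite subr0.
move=> c u v [y Fy Wu] [z Fz Wv]; exists (c *: y + z); first exact: FP.
by rewrite opprD addrACA -scalerBr; exact: WP.
Qed.

(** Within one iteration this is [pod_vec_decomp].  A vector of an earlier
    iteration lies in [V_b], since its eigenvector is the sum of a multiple of
    its basis function and of an interpolant. *)
Lemma pod_vec_flag t l : (l < t)%N -> (t < n * m)%N ->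
  flag (t %/ m) (t %% m) (pod_vec (l %/ m) (l %% m)).
Proof.
move=> lt tn; have ln := ltn_trans lt tn.
have tb := divn_block t tn; have lb := divn_block l ln.
have lm : (l %% m < m)%N by rewrite ltn_mod.
have dec := pod_vec_decomp _ _ lb lm.
have := leq_div2r m (ltnW lt); rewrite leq_eqVlt => /predU1P[lE|lltb].
  exists ((Num.sqrt (lam (l %/ m) (l %% m)) / c0) *: f (l %/ m) (l %% m)).
    apply: subspaceZ; first exact: subspace_lin_span.
    apply: lin_span_gen; exists (l %% m)%N; last by rewrite lE.
    by move: lt; rewrite {1}(divn_eq t m) {1}(divn_eq l m) lE ltn_add2l.
  by rewrite -lE.
exists 0; first by case: (subspace_lin_span [set v | exists2 i, (i < t %% m)%N & v = f (t %/ m) i]).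
rewrite subr0 -(subrK ((Num.sqrt (lam (l %/ m) (l %% m)) / c0) *: f (l %/ m) (l %% m)) (pod_vec _ _)).
have lmt : (l.+1 <= t %/ m * m)%N.
  rewrite {1}(divn_eq l m); apply: leq_trans (leq_mul lltb (leqnn m)).
  by rewrite mulSn addnC ltn_add2r.
apply: subspaceD; first exact: subspace_lin_span.
  apply: interp_space_mono dec; rewrite leq_mul2r ltnW ?orbT //.
apply: subspaceZ; first exact: subspace_lin_span.
apply: (interp_space_mono D _ _ lmt).
have [_ _ g0 bE] := greedy_interp_step l ln.
rewrite -[X in _ X](subrK (interp ev D l (f (l %/ m) (l %% m)))).
apply: subspaceD; first exact: subspace_lin_span.
  rewrite -[X in _ X]scale1r -(mulfV g0) -scalerA -bE.
  apply: subspaceZ; first exact: subspace_lin_span.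
  by apply: lin_span_gen; exists l.
by apply: interp_space_mono (interp_in_space _ _ _ _).
Qed.

(** Up to [V_b], the difference [pod_vec b k - u] is
    [q = (sqrt lam / c0) f b k - z] with [z] in the span of the previous
    eigenvectors of the same iteration.  By orthonormality
    [|q| >= sqrt lam / c0], and since [Pi_b] maps [q] to 0, the projection
    error of [q] is [|q|] itself. *)
Lemma dist_flag_ge b k u : (b < n)%N -> (k < m)%N -> flag b k u ->
  Num.sqrt (lam b k) / c0 / (1 + L b) <= `|pod_vec b k - u|.
Proof.
move=> bn km [z Fz Wu].
have L1 : 0 < 1 + L b by rewrite ltr_pwDl ?L_ge0.
rewrite ler_pdivrMr // [leRHS]mulrC.
set s := Num.sqrt (lam b k) / c0.
have s0 : 0 <= s by rewrite divr_ge0 ?sqrtr_ge0 ?(ltW c0_gt0).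
pose q := s *: f b k - z.
have [Sz [z0 fz]] : S z /\ Pi m ev D b z = 0 /\ dot (f b k) z = 0.
  pose X := [set v | (S v /\ Pi m ev D b v = 0) /\ dot (f b k) v = 0].
  suff sub : lin_span [set v | exists2 l, (l < k)%N & v = f b l] `<=` X.
    by have [[? ?] ?] := sub z Fz.
  apply: lin_span_sub.
    have [K0 KP] := Pi_ker_subspace b (ltnW bn).
    split; first by split=> //; exact: linear0r.
    move=> c x y [Kx x0] [Ky y0]; split; first exact: KP.
    by rewrite linearDr /= (dotZr dot) x0 y0 mulr0 addr0.
  move=> _ [l lk ->]; have lm := ltn_trans lk km; split.
    by split; [exact: eigvec_in_span|exact: Pi_eigvec].
  by rewrite eigvec_orthonormal // gtn_eqF.
have sq : s <= `|q|.
  have fq : dot (f b k) q = s.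
    by rewrite linearBr /= (dotZr dot) fz eigvec_orthonormal // eqxx mulr1 subr0.
  have := bessel dot dot_norm 1 (fun=> f b k) q.
  rewrite big_ord1 fq => bes.
  rewrite -(@ler_pXn2r _ 2) ?nnegrE //; apply: bes.
  by case=> [|i] // [|j] // _ _; rewrite eigvec_orthonormal // !eqxx.
have [Sq Pq] : S q /\ Pi m ev D b q = 0.
  apply: (@subspaceB _ _ [set v | S v /\ Pi m ev D b v = 0]).
  - exact: (Pi_ker_subspace b (ltnW bn)).
  - apply: subspaceZ; first exact: (Pi_ker_subspace b (ltnW bn)).
    by split; [exact: eigvec_in_span|exact: Pi_eigvec].
  - by [].
have Ww : W (b * m) ((u - z) - (pod_vec b k - s *: f b k)).
  apply: subspaceB => //; [exact: subspace_lin_span|exact: pod_vec_decomp].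
have := interp_error_le b q _ bn Sq Ww; rewrite Pq subr0.
have -> : q - (u - z - (pod_vec b k - s *: f b k)) = pod_vec b k - u.
  by rewrite /q opprB (opprB u) addrCA !subrKA.
exact: le_trans.
Qed.

(** Every mode of an iteration is bounded below by the last one, so the volume
    bound for [n * m] vectors is the [m]-th power of the one claimed. *)
Lemma eigval_volume_le (e : R) (x : 'I_(2 ^ (n * m)) -> V) :
  (0 < n)%N -> 0 < e ->
  sym_convex_hull (slices P a) `<=` \bigcup_i ball (x i) e ->
  \prod_(b < n) (Num.sqrt (eigval D b.+1 m) / c0 / (1 + L b)) <=
    (4 * expR 1 ^+ 2 * e * Num.sqrt (n * m)%:R) ^+ n.
Proof.
move=> n0 e0 cov.
pose kap b := Num.sqrt (eigval D b.+1 m) / c0 / (1 + L b).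
have kap0 b : (b < n)%N -> 0 < kap b.
  move=> bn; rewrite /kap !divr_gt0 ?c0_gt0 ?sqrtr_gt0 ?eigval_gt0 //.
  by rewrite ltr_pwDl ?L_ge0.
have vol : \prod_(t < n * m) kap (t %/ m)%N <=
    (4 * expR 1 ^+ 2 * e * Num.sqrt (n * m)%:R) ^+ (n * m).
  apply: (prod_dist_le_cover dot dot_norm (n * m) _
    (fun t => pod_vec (t %/ m) (t %% m)) (fun t => kap (t %/ m)%N) e x) cov => //.
  - by rewrite muln_gt0 n0.
  - by move=> t tn; apply: kap0; exact: divn_block.
  - move=> t c tn; have bn := divn_block t tn.
    have km : (t %% m < m)%N by rewrite ltn_mod.
    have fl : flag (t %/ m) (t %% m)
        (\sum_(l < t) c l *: pod_vec (l %/ m) (l %% m)).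
      by apply: subspace_sum; [exact: subspace_flag|move=> l; exact: pod_vec_flag].
    apply: le_trans (dist_flag_ge _ _ _ bn km fl).
    rewrite /kap !ler_wpM2r ?invr_ge0 ?(ltW c0_gt0) ?addr_ge0 ?L_ge0 //.
    apply: ler_wsqrtr; have [_ _ [_ _ mono _] _] := greedy_stepP _ bn.
    exact: mono.
  - move=> c c1.
    pose g t j := (c0 * Num.sqrt (lam (t %/ m) (t %% m)))^-1 * coef (t %/ m) (t %% m) j.
    have -> : \sum_(t < n * m) c t *: pod_vec (t %/ m) (t %% m) =
        \sum_(q : 'I_(n * m) * 'I_J.+1) (c q.1 * g q.1 q.2) *: a (sel D (q.1 %/ m).+1) q.2.
      rewrite -(pair_bigA _ (fun t j => (c t * g t j) *: a (sel D (t %/ m).+1) j)) /=.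
      apply: eq_bigr => t _; rewrite /pod_vec !scaler_sumr.
      by apply: eq_bigr => j _; rewrite !scalerA /g -!mulrA.
    apply: sym_convex_hull_fin.
      move=> [t j]; exists (sel D (t %/ m).+1); last by exists j.
      exact/sel_in/divn_block.
    rewrite -(pair_bigA _ (fun t j => `|c t * g t j|)) /=.
    apply: le_trans c1; apply: ler_sum => t _.
    under eq_bigr do rewrite normrM.
    rewrite -mulr_sumr ler_piMr // pod_vec_coef ?ltn_mod //.
    exact: divn_block.
move: vol; rewrite -(big_mkord xpredT (fun t => kap (t %/ m)%N)) big_nat_mul.
rewrite (eq_big_nat _ _ (F2 := fun b => kap b ^+ m)); last first.
  move=> b _; rewrite (eq_big_nat _ _ (F2 := fun=> kap b)).
    by rewrite prodr_const_nat mulSn addnK.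
  move=> t /andP[bt tb]; congr kap; apply/eqP.
  by rewrite eqn_leq -ltnS ltn_divLR // tb leq_divRL.
rewrite prodrXl exprM big_mkord ler_pXn2r //.
- by rewrite nnegrE; apply: prodr_ge0 => b _; exact: ltW (kap0 _ _).
- by rewrite nnegrE !exprn_ge0 // !mulr_ge0 ?exprn_ge0 ?expR_ge0 ?sqrtr_ge0 ?(ltW e0).
Qed.

(** Each factor [sqrt lam^m / (c0 (1 + L b))] of [eigval_volume_le] is at least
    [beta / eta b], where [beta] is the last error divided by
    [(1 + L (n - 1)) c0 sqrt (J + 1)]; the [n]-th root of the product of these
    inequalities is the claim. *)
Lemma sigma_bound (e : R) (x : 'I_(2 ^ (n * m)) -> V) :
  (0 < n)%N -> 0 < e ->
  sym_convex_hull (slices P a) `<=` \bigcup_i ball (x i) e ->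
  normT dot T (r n.-1) <=
    (c0 * Num.sqrt J.+1%:R * (4 * expR 1 ^+ 2) * Num.sqrt m%:R) *
    (1 + L n.-1) *
    (\prod_(b < n) ((1 + L b) / Num.sqrt (theta m D b.+1))) `^ n%:R^-1 *
    n%:R `^ 2^-1 * e.
Proof.
move=> n0 e0 cov.
have nn : (n.-1 < n)%N by rewrite prednK.
pose eta b := (1 + L b) / Num.sqrt (theta m D b.+1).
have th0 b : (b < n)%N -> 0 < theta m D b.+1.
  by move=> bn; rewrite divr_gt0 ?eigval_gt0 ?eigval_pos.
have L1 b : (b < n)%N -> 0 < 1 + L b by move=> bn; rewrite ltr_pwDl ?L_ge0.
have eta0 b : (b < n)%N -> 0 < eta b.
  by move=> bn; rewrite divr_gt0 ?L1 // sqrtr_gt0 th0.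
pose q := c0 * Num.sqrt J.+1%:R.
have q0 : 0 < q by rewrite mulr_gt0 ?c0_gt0 // sqrtr_gt0.
have Lq0 : 0 < (1 + L n.-1) * q by exact: mulr_gt0 (L1 _ nn) q0.
pose beta := normT dot T (r n.-1) / ((1 + L n.-1) * q).
have beta0 : 0 <= beta.
  by rewrite divr_ge0 ?sqrtr_ge0 ?(ltW Lq0).
pose Q := 4 * expR 1 ^+ 2 * e * Num.sqrt (n * m)%:R.
have Q0 : 0 <= Q by rewrite !mulr_ge0 ?exprn_ge0 ?expR_ge0 ?sqrtr_ge0 ?(ltW e0).
have beta_le b : (b < n)%N ->
    beta <= eta b * (Num.sqrt (eigval D b.+1 m) / c0 / (1 + L b)).
  move=> bn.
  have -> : eta b * (Num.sqrt (eigval D b.+1 m) / c0 / (1 + L b)) =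
      Num.sqrt (lam b 0) / c0.
    have lE : eigval D b.+1 m = theta m D b.+1 * lam b 0.
      by rewrite /theta divfK ?gt_eqF ?eigval_pos.
    rewrite lE sqrtrM ?(ltW (th0 b bn)) // /eta; field.
    by rewrite !gt_eqF ?c0_gt0 ?L1 ?sqrtr_gt0 ?th0.
  rewrite /beta (ler_pdivrMr _ _ Lq0).
  have bn1 : (b <= n.-1)%N by rewrite -ltnS prednK.
  apply: le_trans (residual_norm_le b n.-1 bn1 nn) _.
  have -> : Num.sqrt (lam b 0) / c0 * ((1 + L n.-1) * q) =
     (1 + L n.-1) * (Num.sqrt J.+1%:R * Num.sqrt (lam b 0)).
    by rewrite /q; field; rewrite gt_eqF ?c0_gt0.
  apply: ler_wpM2l; first exact: ltW (L1 _ nn).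
  exact: residual_norm_le_eigval.
have E0 : 0 <= \prod_(b < n) eta b by apply: prodr_ge0 => i _; exact: ltW (eta0 _ _).
have pow : beta ^+ n <= (\prod_(b < n) eta b) * Q ^+ n.
  apply: le_trans (ler_wpM2l E0 (eigval_volume_le e x n0 e0 cov)).
  rewrite -big_split /= -[X in beta ^+ X]card_ord -prodr_const.
  by apply: ler_prod => i _; rewrite beta0 beta_le.
have n1 : 0 <= n%:R^-1 :> R by [].
have npos : n%:R != 0 :> R by rewrite pnatr_eq0 -lt0n.
have root (y : R) : 0 <= y -> (y ^+ n) `^ n%:R^-1 = y.
  by move=> y0; rewrite -powR_mulrn // -powRrM mulfV // powRr1.
have main : beta <= (\prod_(b < n) eta b) `^ n%:R^-1 * Q.
  rewrite -(root _ beta0) -[X in _ * X](root _ Q0) -powRM ?exprn_ge0 //.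
  by apply: ge0_ler_powR; rewrite ?nnegrE ?mulr_ge0 ?exprn_ge0.
move: main; rewrite /beta (ler_pdivrMr _ _ Lq0) => main.
apply: le_trans main _.
rewrite powR12_sqrt // /Q natrM sqrtrM // le_eqVlt; apply/orP; left; apply/eqP.
rewrite -/q /eta; ring.
Qed.

End Greedy.

(** * Finite and infinite right-hand sides *)

Lemma prode_gt0 (R : realType) (F : nat -> \bar R) (n : nat) :
  (forall i, (0 < F i)%E) -> (0 < \prod_(1 <= i < n.+1) F i)%E.
Proof. by move=> F0; elim/big_ind: _ => // x y; exact: mule_gt0. Qed.

Lemma prode_eqy (R : realType) (F : nat -> \bar R) (n i : nat) :
  (forall i, (0 < F i)%E) -> (1 <= i <= n)%N -> F i = +oo%E ->
  (\prod_(1 <= i < n.+1) F i)%E = +oo%E.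
Proof.
move=> F0 + Fi; elim: n => [|n IH]; first by case: i {Fi}.
case/andP => i1; rewrite leq_eqVlt => /predU1P[iE|ltin].
  rewrite iE in Fi.
  by rewrite big_nat_recr //= Fi gt0_muley //; exact: prode_gt0.
by rewrite big_nat_recr //= IH ?i1 //= gt0_mulye.
Qed.

Section InterpolationNorms.
Context {R : realType} {V : completeNormedModType R}.
Context {dot : {dot V for (@idfun R)}} {T : R} {J m : nat}.
Context {Omega : Type} {Sigma : set Omega} {ev : evaluation V Sigma} {d : nat}.
Context {P : set 'rV[R]_d} {a : 'rV[R]_d -> 'I_J.+1 -> V} {D : eim_data R V Omega d}.
Context {N n : nat}.
Hypothesis m_gt0 : (0 < m)%N.
Hypothesis greedy : eim_pod_greedy dot T m ev P a D N.
Hypothesis n_bounds : (1 <= n <= N)%N.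
Hypothesis eigval1_gt0 : forall i, (1 <= i <= n)%N -> 0 < eigval D i 1%N.

(** If all slices vanished, the first residual and its correlation operator would
    vanish too, against the positivity of the first eigenvalue.  A nonzero slice
    makes the supremum [Lambda] run over a nonempty set, hence nonnegative, and
    the entropy number positive. *)
Lemma nonzero_slice : exists2 g, slices P a g & g != 0.
Proof.
have [n1 nN] := andP n_bounds.
have [Psel _ [eig on _ _] _] : greedy_step dot T m ev P a D 1.
  by case: greedy => _; apply; rewrite /= (leq_trans n1 nN).
have lam0 : 0 < eigval D 1 1 by apply: eigval1_gt0; rewrite n1.
apply: contrapT => none.
have a0 j : a (sel D 1%N) j = 0.
  by apply: contrapT => /eqP aj; apply: none; exists (a (sel D 1%N) j) => //;
     exists (sel D 1%N) => //; exists j.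
have r0 j : residualT m ev a D 1 (sel D 1%N) j = 0.
  by rewrite /residualT /PiT /Pi /interp a0 mul0n big_ord0 subrr.
have := eig 1%N; rewrite /= m_gt0 => /(_ isT).
rewrite /correlation big1 => [/esym/eqP|j _]; last by rewrite r0 scaler0.
rewrite scaler_eq0 gt_eqF //= => /eqP f0.
have := on 1%N 1%N; rewrite /= m_gt0 f0 linear0l => /(_ isT isT)/eqP.
by rewrite eq_sym oner_eq0.
Qed.

Lemma Lambda_ge0 b : (0 <= Lambda m ev P a D b)%E.
Proof.
have [g Kg g0] := nonzero_slice.
apply: (@le_trans _ _ (`|Pi m ev D b g| / `|g|)%:E).
  by rewrite lee_fin divr_ge0.
by apply: ereal_sup_ubound; exists g => //; split => //; exact: lin_span_gen.
Qed.

Lemma Lambda_bound b (l : R) v : (b <= n)%N -> Lambda m ev P a D b = l%:E ->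
  lin_span (slices P a) v -> `|Pi m ev D b v| <= l * `|v|.
Proof.
move=> bn lE Sv; have [->|v0] := eqVneq v 0.
  have tri := block_triangular m_gt0 greedy (proj2 (andP n_bounds)) b bn.
  by rewrite /Pi interp0 // normr0 mulr0.
have nv : 0 < `|v| by rewrite normr_gt0.
rewrite -ler_pdivrMr // -lee_fin -lE.
by apply: ereal_sup_ubound; exists v.
Qed.

End InterpolationNorms.

Theorem theorem4p1 (R : realType) (T : R) (J m : nat)
    (T_gt0 : 0 < T) (J_ge1 : (1 <= J)%N) (m_ge1 : (1 <= m)%N) :
  exists2 C : R, 0 < C &
  forall (V : completeNormedModType R) (dot : {dot V for (@idfun R)})
    (dot_norm : forall v : V, dot v v = `|v| ^+ 2)
    (Omega : Type) (Sigma : set Omega) (ev : evaluation V Sigma)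
    (d : nat) (P : set 'rV[R]_d) (a : 'rV[R]_d -> 'I_J.+1 -> V)
    (D : eim_data R V Omega d) (N : nat),
  eim_pod_greedy dot T m ev P a D N ->
  forall n : nat, (1 <= n <= N)%N ->
  (forall i : nat, (1 <= i <= n)%N -> 0 < eigval D i 1%N) ->
  (sigma_hat dot T m ev P a D n <=
     C%:E * (1 + Lambda m ev P a D n.-1)
     * (\prod_(1 <= i < n.+1)
          ((1 + Lambda m ev P a D i.-1) * (Num.sqrt (theta m D i))%:E^-1))
       `^ (n%:R^-1)
     * (n%:R `^ (2%:R^-1))%:E
     * entropy_number (m * n) (sym_convex_hull (slices P a)))%E.
Proof.
have tau0 : 0 < tau T J by rewrite divr_gt0 // ltr0n.
pose C : R := J.+1%:R * Num.sqrt (tau T J) * Num.sqrt J.+1%:R *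
  (4 * expR 1 ^+ 2) * Num.sqrt m%:R.
have C0 : 0 < C by rewrite !mulr_gt0 ?sqrtr_gt0 ?exprn_gt0 ?expR_gt0 ?ltr0n.
exists C => // V dot dot_norm Omega Sigma ev d P a D N greedy n nN eig1.
have [n1 n_le] := andP nN.
have [g Kg g0] := nonzero_slice m_ge1 greedy nN eig1.
have E0 := entropy_number_gt0 (m * n) _ g Kg g0.
have Lam0 := Lambda_ge0 m_ge1 greedy nN eig1.
have Lam1 b : (0 < 1 + Lambda m ev P a D b)%E by apply: (@lt_le_trans _ _ 1%E); rewrite ?lte01 ?leeDl.
have nR : n%:R != 0 :> R by rewrite pnatr_eq0 -lt0n.
have npow : 0 < n%:R `^ 2%:R^-1 :> R by rewrite powR_gt0 // ltr0n.
set F := fun i : nat => ((1 + Lambda m ev P a D i.-1) * (Num.sqrt (theta m D i))%:E^-1)%E.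
have F0 i : (0 < F i)%E.
  rewrite mule_gt0 //; rewrite inver; case: ifPn => // s0.
  by rewrite lte_fin invr_gt0 lt_neqAle eq_sym s0 sqrtr_ge0.
(* An infinite factor makes the right-hand side infinite, because all the
   other factors are positive. *)
have [[i [i1 Fi]]|fin] := pselect (exists i, (1 <= i <= n)%N /\ F i = +oo%E).
  rewrite (prode_eqy _ _ _ i) // poweRyr ?invr_eq0 //.
  rewrite gt0_muley; last by rewrite mule_gt0 // lte_fin.
  by rewrite gt0_mulye ?lte_fin // gt0_mulye // leey.
pose L b := fine (Lambda m ev P a D b).
have s0 b : (b < n)%N -> 0 < Num.sqrt (theta m D b.+1).
  move=> bn; rewrite lt_neqAle sqrtr_ge0 andbT eq_sym; apply/eqP => s0.
  by apply: fin; exists b.+1; split => //; rewrite /F s0 inve0 gt0_muley.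
have LE b : (b < n)%N -> Lambda m ev P a D b = (L b)%:E.
  move=> bn; rewrite fineK // fin_numElt (lt_le_trans _ (Lam0 b)) //=.
  rewrite ltey; apply/eqP => Ly; apply: fin; exists b.+1; split => //.
  by rewrite /F /= Ly addey // gt0_mulye // inver gt_eqF ?s0 // lte_fin invr_gt0 s0.
have L0 b : (b < n)%N -> 0 <= L b by move=> _; exact: fine_ge0.
have eigm b : (b < n)%N -> 0 < eigval D b.+1 m.
  move=> bn; have := s0 b bn; rewrite sqrtr_gt0 /theta pmulr_lgt0 //.
  by rewrite invr_gt0 eig1.
have Lb b v : (b < n)%N -> lin_span (slices P a) v -> `|Pi m ev D b v| <= L b * `|v|.
  move=> bn; apply: (Lambda_bound m_ge1 greedy nN); [exact: ltnW|exact: LE].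
have nn : (n.-1 < n)%N by rewrite prednK.
have sE := sigma_hatE greedy n_le n.-1 nn; rewrite prednK // in sE.
rewrite sE LE // -EFinD.
rewrite (eq_big_nat _ _ (F2 := fun i => ((1 + L i.-1) / Num.sqrt (theta m D i))%:E)); last first.
  case=> // b; rewrite ltnS => bn; rewrite /F /= LE // inver gt_eqF ?s0 //.
rewrite prodEFin poweR_EFin -!EFinM big_add1 big_mkord.
set K := (X in (X%:E * entropy_number _ _)%E).
have K0 : 0 < K.
  apply: mulr_gt0 npow; apply: mulr_gt0; first by rewrite mulr_gt0 // ltr_pwDl ?L0.
  apply/powR_gt0/prodr_gt0 => b _.
  by rewrite divr_gt0 ?s0 /= ?ltr_pwDl ?L0 ?ltn_ord.
rewrite -lee_pdivrMl //; apply/ereal_infP => _ [e [e0 [x cov]] <-].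
rewrite -EFinM lee_fin ler_pdivrMl //.
move: x cov; rewrite [(m * n)%N]mulnC => x cov.
have := sigma_bound dot_norm tau0 m_ge1 greedy n_le eigm L0 Lb e x n1 e0 cov.
by rewrite prednK.
Qed.
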